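(* There are absolute constants $c,C>0$ such that the following holds. Let $\beta^*\in\mathbb R^d$ have at most $k$ nonzero entries, $\mathbf X\in\mathbb R^{n\times d}$ have i.i.d. $N(0,1)$ entries, and $\eta\in\mathbb R^n$ be deterministic with $|\{i:|\eta_i|\le1\}|\ge\alpha n$ for some $\alpha\in(0,1]$; let $\mathbf y=\mathbf X\beta^*+\eta$. Let $\hat\beta$ be obtained by running the Coordinate-wise Median Algorithm on $(\mathbf y,\mathbf X)$ to get $\beta'$, and then keeping the $k$ entries of $\beta'$ of largest absolute value and setting all other entries to $0$. Then for any $0<\tau\le\alpha^2n$, \[\|\beta^*-\hat\beta\|^2\le C\cdot\frac{k\,\tau}{\alpha^2n}\big(1+\|\beta^*\|^2\big)\] with probability at least $1-2\exp(\ln d-c\tau)$.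
   Context: Coordinate-wise Median Algorithm on input $(y,X)\in\mathbb R^n\times\mathbb R^{n\times d}$: sample independent $w_i\sim N(0,1)$ and Rademacher signs $\sigma_i$, independent of everything else, and set $y'_i=\sigma_iy_i+w_i$, $X'_{i,\cdot}=\sigma_iX_{i,\cdot}$. For each $j\in[d]$ let $M_j=\{i:|X'_{ij}|\ge1/2\}$ and let $\beta'_j$ be the median of $\{y'_i/X'_{ij}:i\in M_j\}$. Output $\beta'=(\beta'_1,\dots,\beta'_d)$. *)

(* Defs.v *)
From HB Require Import structures.
From mathcomp Require Import all_boot all_order all_algebra.
From mathcomp Require Import all_classical all_reals all_analysis.
Set Implicit Arguments. Unset Strict Implicit. Unset Printing Implicit Defensive.
Import Order.TTheory GRing.Theory Num.Theory.
Local Open Scope classical_set_scope.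
Local Open Scope ring_scope.

(* Lower median of a finite list of reals (element of rank ceil(m/2) in sorted
   order); 0 for the empty list. *)
Definition median {R : realType} (s : seq R) : R :=
  nth 0 (sort <=%R s) ((size s).-1 %/ 2).

(* Coordinate-wise Median Algorithm, given the realised signs sg, Gaussian
   noise w, the data y and design X. *)
Definition cm_beta' {R : realType} (n d : nat) (sg w y : 'I_n -> R) (X : 'I_n -> 'I_d -> R)
  : 'I_d -> R :=
  fun j =>
    let y' := fun i => sg i * y i + w i in
    let X' := fun i => sg i * X i j in
    median [seq y' i / X' i | i <- enum 'I_n & 2^-1 <= `|X' i|].

Definition topk_rank {R : realType} (d : nat) (b : 'I_d -> R) (j : 'I_d) : nat :=
  #|[set i : 'I_d | (`|b j| < `|b i|) || ((`|b i| == `|b j|) && (val i < val j)%N)]%SET|.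

Definition in_topk {R : realType} (d k : nat) (b : 'I_d -> R) (j : 'I_d) : bool :=
  (topk_rank b j < k)%N.

Definition hard_threshold {R : realType} (d k : nat) (b : 'I_d -> R) : 'I_d -> R :=
  fun j => if in_topk k b j then b j else 0.

Definition sqnorm {R : realType} (d : nat) (v : 'I_d -> R) : R := \sum_(j < d) v j ^+ 2.

Definition mutually_independent {R : realType} {dT} {T : measurableType dT} {I : finType}
  (P : probability T R) (Z : I -> T -> R) : Prop :=
  forall (J : {set I}) (B : I -> set R), (forall i, measurable (B i)) ->
    P (\bigcap_(i in [set` J]) (Z i @^-1` B i)) =
    (\prod_(i in J) P (Z i @^-1` B i))%E.

Definition std_gaussian {R : realType} {dT} {T : measurableType dT}
  (P : probability T R) (Z : T -> R) : Prop :=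
  measurable_fun setT Z /\
  forall B : set R, measurable B -> P (Z @^-1` B) = normal_prob 0 1 B.

Definition rademacher {R : realType} {dT} {T : measurableType dT}
  (P : probability T R) (Z : T -> R) : Prop :=
  measurable_fun setT Z /\ (forall t, Z t = 1 \/ Z t = -1) /\
  P (Z @^-1` [set 1]) = (2^-1)%:E /\ P (Z @^-1` [set -1]) = (2^-1)%:E.

Definition rand_family {R : realType} (n d : nat) {T : Type}
  (X : 'I_n -> 'I_d -> T -> R) (w sg : 'I_n -> T -> R) :
  ('I_n * 'I_d + 'I_n + 'I_n)%type -> T -> R :=
  fun a => match a with
           | inl (inl ij) => X ij.1 ij.2
           | inl (inr i) => w i
           | inr i => sg i
           end.

(* Main.v *)
Require Import Defs.
From HB Require Import structures.
From mathcomp Require Import all_boot all_order all_algebra.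
From mathcomp Require Import all_classical all_reals all_analysis.
From mathcomp Require Import measurable_realfun.
From mathcomp Require Import ring lra zify.
Set Implicit Arguments. Unset Strict Implicit. Unset Printing Implicit Defensive.
Import Order.TTheory GRing.Theory Num.Theory.
Local Open Scope classical_set_scope.
Local Open Scope ring_scope.

(* Fix a coordinate j. Multiplying numerator and denominator of y'_i / X'_ij by
   the sign sigma_i gives y'_i / X'_ij = beta_j + z_i / X_ij, where
   z_i = eta_i + sigma_i w_i + sum_(l <> j) beta_l X_il is independent of X_ij and
   has law N(eta_i, 1 + sum_(l <> j) beta_l^2). Since X_ij is symmetric, so is
   the ratio z_i / X_ij, whatever eta_i is: every sample votes for "beta_j is
   overestimated" and "underestimated" without bias, except for the mass that
   the ratio gives to [-e, e], which pushes the median towards beta_j. For the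
   alpha n samples with |eta_i| <= 1 that mass is at least of order
   delta = sqrt (tau / (alpha^2 n)) when e = 2 delta sqrt (1 + |beta|^2), and a
   Chernoff bound over the n independent votes gives |beta'_j - beta_j| <= e up
   to probability 2 exp (- c tau). A union bound over j controls the sup norm,
   and hard thresholding then costs at most 5 k e^2. *)

(** * Independence of blocks of a mutually independent family *)

Section independence.
Context {R : realType} {dT : measure_display} {T : measurableType dT}
        (P : probability T R).

(** Both sides are finite measures in [A]: [P] restricted to [E], and [P] scaled by [P E]. They
    agree on the pi-system [G] and on [setT], hence on the generated sigma-algebra. *)
Lemma indep_sigma (G : set (set T)) (E : set T) : setI_closed G ->
  G `<=` measurable -> measurable E ->
  (forall A, G A -> P (A `&` E) = (P A * P E)%E) ->
  forall A, <<s G >> A -> P (A `&` E) = (P A * P E)%E.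
Proof.
move=> GI Gm mE GE A sA.
have PEfin : P E \is a fin_num by exact: fin_num_measure.
have r0 : 0 <= fine (P E) by exact: fine_ge0.
pose r := NngNum r0.
pose m1 : {measure set T -> \bar R} := mrestr P mE.
pose m2 : {measure set T -> \bar R} := mscale r P.
have m2E B : m2 B = (P B * P E)%E.
  by rewrite /m2 /= /mscale /= fineK// muleC.
have <- : m1 A = P (A `&` E) by [].
rewrite -m2E.
have HG : [set X | G X /\ X `<=` setT] = G.
  by apply/seteqP; split => [X []|X GX].
apply: (@g_sigma_algebra_measure_unique_trace _ _ _ G setT) => //.
- by rewrite HG.
- by rewrite HG.
- by rewrite m2E probability_setT mul1e /m1 /= /mrestr setTI.
- by move=> B [GB _]; rewrite m2E /m1 /= /mrestr GE.
- by rewrite /m1 /= /mrestr setTI -ge0_fin_numE.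
- by rewrite HG.
Qed.

(** One index at a time passes from the pi-system to its sigma-algebra: in the induction, [s] lists
    the indices already enlarged, and [indep_sigma] enlarges [k0] against the intersection [E] of
    the other sets. *)
Lemma indep_sigma_family (K : finType) (G : K -> set (set T)) :
  (forall k, setI_closed (G k)) -> (forall k, G k setT) ->
  (forall k, G k `<=` measurable) ->
  (forall A : K -> set T, (forall k, G k (A k)) ->
     P (\bigcap_(k in setT) A k) = (\prod_k P (A k))%E) ->
  forall A : K -> set T, (forall k, <<s G k >> (A k)) ->
    P (\bigcap_(k in setT) A k) = (\prod_k P (A k))%E.
Proof.
move=> GI GT Gm GP.
have sGm k : <<s G k >> `<=` measurable.
  exact: smallest_sub (@sigma_algebra_measurable _ T) (@Gm k).
suff H (s : seq K) : forall A : K -> set T,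
    (forall k, k \in s -> <<s G k >> (A k)) ->
    (forall k, k \notin s -> G k (A k)) ->
    P (\bigcap_(k in setT) A k) = (\prod_k P (A k))%E.
  move=> A sA; apply: (H (enum K)) => // k.
  by rewrite mem_enum.
elim: s => [|k0 s IH] A sA gA; first by apply: GP => k; exact: gA.
have mA k : measurable (A k).
  have [ks|ks] := boolP (k \in k0 :: s); first by apply: (@sGm k); exact: sA.
  by apply: (@Gm k); exact: gA.
pose E := \bigcap_(k in [set k | k != k0]) A k.
have mE : measurable E by apply: fin_bigcap_measurable => [|k _]; [exact: finite_finset|]; exact: mA.
pose A' B := fun k => if k == k0 then B else A k.
have capE B : \bigcap_(k in setT) A' B k = B `&` E.
  apply/seteqP; split => [t Ht|t [tB tE] k _].
    split; first by have := Ht k0 Logic.I; rewrite /A' eqxx.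
    by move=> k /negbTE kk0; have := Ht k Logic.I; rewrite /A' kk0.
  by rewrite /A'; case: eqVneq => // kk0; exact: tE.
have prodE B : (\prod_k P (A' B k) = P B * \prod_(k | k != k0) P (A k))%E.
  rewrite (bigD1 k0)//= {1}/A' eqxx; congr (_ * _)%E.
  by apply: eq_bigr => k /negbTE kk0; rewrite /A' kk0.
have GB B : G k0 B -> P (B `&` E) = (P B * \prod_(k | k != k0) P (A k))%E.
  move=> gB; rewrite -capE -prodE; apply: IH => k ks.
    rewrite /A'; case: eqVneq => [->|kk0]; first exact: sub_sigma_algebra.
    by apply: sA; rewrite inE ks orbT.
  rewrite /A'; case: eqVneq => [->//|kk0].
  by apply: gA; rewrite inE negb_or kk0.
have PE : P E = (\prod_(k | k != k0) P (A k))%E.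
  by rewrite -(setTI E) GB// probability_setT mul1e.
have AE : A = A' (A k0).
  by apply/funext => k; rewrite /A'; case: eqVneq => // ->.
rewrite AE capE prodE -PE; apply: (@indep_sigma (G k0)) => //.
  by move=> B gB; rewrite GB// PE.
by apply: sA; rewrite mem_head.
Qed.

Section blocks.
Context {I K : finType} (Z : I -> T -> R) (blk : I -> K).

(** Rectangles in the variables of block [k], a pi-system. The sigma-algebra it generates is the
    information carried by the block; measurability for it expresses being a function of these
    variables only. *)
Definition block_sys (k : K) : set (set T) :=
  [set A | exists B : I -> set R, (forall i, measurable (B i)) /\
     A = \bigcap_(i in [set i | blk i = k]) Z i @^-1` B i].

Lemma block_sysI k : setI_closed (block_sys k).
Proof.
move=> _ _ [B [mB ->]] [C [mC ->]]; exists (fun i => B i `&` C i); split.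
  by move=> i; exact: measurableI.
apply/seteqP; split => [t [tB tC] i ik|t tBC].
  by split; [exact: tB|exact: tC].
by split => i ik; have [] := tBC i ik.
Qed.

Lemma block_sysT k : block_sys k setT.
Proof.
exists (fun=> setT); split => //.
by apply/seteqP; split.
Qed.

Lemma measurable_block i : measurable_fun setT (Z i : g_sigma_algebraType (block_sys (blk i)) -> R).
Proof.
move=> _ B mB; rewrite setTI; apply: sub_sigma_algebra.
exists (fun i' => if i' == i then B else setT); split.
  by move=> i'; case: ifP.
apply/seteqP; split => [t tB i' _ /=|t tB]; first by case: eqVneq => // ->.
by have := tB i erefl; rewrite /= eqxx.
Qed.

Lemma measurable_in_block k i : blk i = k ->
  measurable_fun setT (Z i : g_sigma_algebraType (block_sys k) -> R).
Proof. by move=> <-; exact: measurable_block. Qed.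

Context (mZ : forall i, measurable_fun setT (Z i)).

Lemma block_sys_measurable k : block_sys k `<=` measurable.
Proof.
move=> _ [B [mB ->]]; apply: fin_bigcap_measurable => [|i _]; [exact: finite_finset|].
by rewrite -[X in measurable X]setTI; exact: mZ.
Qed.

Lemma block_sigma_measurable k : <<s block_sys k >> `<=` measurable.
Proof.
exact: smallest_sub (@sigma_algebra_measurable _ T) (@block_sys_measurable k).
Qed.

Lemma block_measurable_fun d' (U : measurableType d') k (f : T -> U) :
  measurable_fun setT (f : g_sigma_algebraType (block_sys k) -> U) -> measurable_fun setT f.
Proof. by move=> mf _ B mB; apply: (@block_sigma_measurable k); exact: mf. Qed.

Context (iZ : mutually_independent P Z).

(** For rectangles, mutual independence gives a product over all variables, which is regrouped by
    block; [indep_sigma_family] does the rest. *)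
Lemma indep_blocks (A : K -> set T) : (forall k, <<s block_sys k >> (A k)) ->
  P (\bigcap_(k in setT) A k) = (\prod_k P (A k))%E.
Proof.
apply: (indep_sigma_family block_sysI block_sysT block_sys_measurable).
move=> {}A /choice[B HB].
have PA k : P (A k) = (\prod_(i | blk i == k) P (Z i @^-1` B k i))%E.
  have [mB ->] := HB k.
  have -> : [set i | blk i = k] = [set` [set i | blk i == k]%SET].
    by apply/seteqP; split => i /=; rewrite inE => /eqP.
  rewrite (iZ _ mB); apply: eq_bigl => i; by rewrite inE.
rewrite (eq_bigr _ (fun k _ => PA k)).
transitivity (P (\bigcap_(i in [set` [set: I]%SET]) Z i @^-1` B (blk i) i)).
  congr (P _); apply/seteqP; split => t /= tA.
    by move=> i _; have := tA (blk i) Logic.I; have [_ ->] := HB (blk i); exact.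
  move=> k _; have [_ ->] := HB k => i ik /=.
  by rewrite -ik; apply: tA; rewrite /= inE.
rewrite iZ; last by move=> i; exact: (HB (blk i)).1.
rewrite (partition_big blk predT)//=; apply: eq_bigr => k _.
by apply: eq_big => i; rewrite ?inE//= => /eqP ->.
Qed.

Lemma indep_block_pair d1 d2 (U1 : measurableType d1) (U2 : measurableType d2)
    (k1 k2 : K) (f : T -> U1) (g : T -> U2) : k1 != k2 ->
  measurable_fun setT (f : g_sigma_algebraType (block_sys k1) -> U1) ->
  measurable_fun setT (g : g_sigma_algebraType (block_sys k2) -> U2) ->
  forall A B, measurable A -> measurable B ->
  P (f @^-1` A `&` g @^-1` B) = (P (f @^-1` A) * P (g @^-1` B))%E.
Proof.
move=> k12 mf mg A B mA mB.
(* The remaining blocks receive [setT], which contributes a factor 1. *)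
pose D k := if k == k1 then f @^-1` A else if k == k2 then g @^-1` B else setT.
have k21 : (k2 == k1) = false by rewrite eq_sym; exact/negbTE.
have := @indep_blocks D.
have -> : \bigcap_(k in setT) D k = f @^-1` A `&` g @^-1` B.
  apply/seteqP; split => [t Ht|t [tA tB] k _].
    split; first by have := Ht k1 Logic.I; rewrite /D eqxx.
    by have := Ht k2 Logic.I; rewrite /D k21 eqxx.
  by rewrite /D; case: eqVneq => // _; case: eqVneq.
rewrite (bigD1 k1)//= (bigD1 k2)/=; last by rewrite k21.
rewrite /D eqxx k21 eqxx big1 ?mule1; last first.
  by move=> k /andP[/negbTE -> /negbTE ->]; rewrite probability_setT.
apply => k; case: eqVneq => [->|_]; first by rewrite -[X in <<s _ >> X]setTI; exact: mf.
case: eqVneq => [->|_]; first by rewrite -[X in <<s _ >> X]setTI; exact: mg.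
exact: (@measurableT _ (g_sigma_algebraType (block_sys k))).
Qed.

End blocks.
End independence.

(** * Sums of Gaussian variables *)

Lemma measure_pushforward d1 d2 (T1 : measurableType d1) (T2 : measurableType d2)
  (R : realFieldType) (m : {measure set T1 -> \bar R}) (f : T1 -> T2) :
  measurable_fun setT f ->
  {m' : {measure set T2 -> \bar R} | forall A, m' A = m (f @^-1` A)}.
Proof.
by move=> mf; unshelve refine (exist _ (pushforward m f : {measure set T2 -> \bar R}) _).
Qed.

Section gaussian.
Context {R : realType}.
Notation mu := (@lebesgue_measure R).
Local Open Scope ereal_scope.

(** The density is a Radon-Nikodym derivative of the normal law, and such derivatives agree almost
    everywhere. *)
Lemma integral_normal_prob (m s : R) (f : R -> \bar R) : s != 0%R ->
  measurable_fun setT f ->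
  (\int[normal_prob m s]_x `|f x| < +oo) ->
  \int[normal_prob m s]_x f x = \int[mu]_x (f x * (normal_pdf m s x)%:E).
Proof.
move=> s0 mf finf.
have dom := normal_prob_dominates m s.
rewrite -(Radon_Nikodym_change_of_variables dom)//=; last first.
  by apply/integrableP; split.
have mpdf : measurable_fun setT (fun x => (normal_pdf m s x)%:E).
  by apply/measurable_EFinP; exact: measurable_normal_pdf.
apply: ae_eq_integral => //.
- exact: emeasurable_funM.
- exact: emeasurable_funM.
- apply: ae_eqe_mul2l => /=.
  rewrite Radon_NikodymE.
  case: cid => /= h [h1 h2 h3].
  apply: integral_ae_eq => //=.
  by move=> E E01 mE; rewrite -h3.
Qed.

Lemma lebesgue_measure_itvoc (u v : R) :
  mu `]u, v]%classic = if (u < v)%R then (v - u)%:E else 0.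
Proof. by rewrite lebesgue_measure_itv/= lte_fin EFinB. Qed.

Lemma lebesgue_measure_itvco (u v : R) :
  mu `[u, v[%classic = if (u < v)%R then (v - u)%:E else 0.
Proof. by rewrite lebesgue_measure_itv/= lte_fin EFinB. Qed.

(** The left side is a measure in [A] that gives every half-open interval its length, so uniqueness
    of Lebesgue measure applies. A negative [b] swaps the closed and the open end, whence the two
    cases. *)
Lemma lebesgue_measure_affine (a b : R) (A : set R) : b != 0%R -> measurable A ->
  (`|b|%:E * mu ((fun x => a + b * x)%R @^-1` A)) = mu A.
Proof.
move=> b0 mA.
have mphi : measurable_fun setT (fun x : measurableTypeR R => (a + b * x)%R : measurableTypeR R).
  by apply: measurable_funD => //; exact: measurable_funM.
have [pm pmE] := measure_pushforward mu mphi.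
pose m0 : {measure set (measurableTypeR R) -> \bar R} :=
  mscale (NngNum (normr_ge0 b)) pm.
transitivity (m0 A); first by rewrite /m0 /= /mscale /= pmE.
apply/esym; apply: (@lebesgue_measure_unique R m0) => //= _ [[u v]] _ <- /=.
rewrite /mscale /= pmE.
have [b1|b1] := ltP 0%R b.
  rewrite (_ : _ @^-1` _ = `]((u - a) / b)%R, ((v - a) / b)%R]%classic).
    have uvE : ((u - a) / b < (v - a) / b)%R = (u < v)%R by rewrite ltr_pM2r ?invr_gt0// ltrD2r.
    rewrite lebesgue_measure_itv/= lte_fin; apply/esym.
    have hm := lebesgue_measure_itvoc ((u - a) / b) ((v - a) / b).
    rewrite uvE in hm.
    transitivity (`|b|%:E * (if (u < v)%R then ((v - a) / b - (u - a) / b)%:E else 0)).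
      by congr (_ * _); exact: hm.
    case: ifP => _; last by rewrite mule0.
    by rewrite -EFinD -EFinM gtr0_norm//; congr EFin; field; rewrite gt_eqF.
  apply/seteqP; split => x /=; rewrite !in_itv/= ltr_pdivrMr// ler_pdivlMr//;
    rewrite [(x * b)%R]mulrC => /andP[? ?]; lra.
have {b0} {}b1 : (b < 0)%R by rewrite lt_neqAle b0.
rewrite (_ : _ @^-1` _ = `[((v - a) / b)%R, ((u - a) / b)%R[%classic).
  have uvE : ((v - a) / b < (u - a) / b)%R = (u < v)%R by rewrite ltr_nM2r ?invr_lt0// ltrD2r.
  rewrite lebesgue_measure_itv/= lte_fin; apply/esym.
  have hm := lebesgue_measure_itvco ((v - a) / b) ((u - a) / b).
  rewrite uvE in hm.
  transitivity (`|b|%:E * (if (u < v)%R then ((u - a) / b - (v - a) / b)%:E else 0)).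
    by congr (_ * _); exact: hm.
  case: ifP => _; last by rewrite mule0.
  by rewrite -EFinD -EFinM ltr0_norm//; congr EFin; field; rewrite lt_eqF.
apply/seteqP; split => x /=; rewrite !in_itv/= ltr_ndivlMr// ler_ndivrMr//;
    rewrite [(x * b)%R]mulrC => /andP[? ?]; lra.
Qed.

Lemma integral_affine (a b : R) (f : R -> \bar R) : b != 0%R ->
  measurable_fun setT f -> (forall x, 0 <= f x) ->
  `|b|%:E * \int[mu]_x f (a + b * x)%R = \int[mu]_x f x.
Proof.
move=> b0 mf f0.
have mphi : measurable_fun setT (fun x : measurableTypeR R => (a + b * x)%R : measurableTypeR R).
  by apply: measurable_funD => //; exact: measurable_funM.
have := @ge0_integral_pushforward _ _ _ _ _ _ mphi mu setT f measurableT mf (fun x _ => f0 x).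
rewrite preimage_setT /= /comp => <-.
have [pm pmE] := measure_pushforward mu mphi.
pose m0 : {measure set (measurableTypeR R) -> \bar R} :=
  mscale (NngNum (normr_ge0 b)) pm.
transitivity (\int[m0]_x f x).
  rewrite ge0_integral_mscale//; congr (_ * _).
  by apply: eq_measure_integral => A mA _; rewrite pmE.
apply: eq_measure_integral => A mA _.
etransitivity; last exact: (lebesgue_measure_affine a b0 mA).
by rewrite /m0 /= /mscale /= pmE.
Qed.

Lemma normal_pdf_nzE (m s x : R) : s != 0%R ->
  normal_pdf m s x = (normal_peak s * normal_fun m s x)%R.
Proof. by move=> s0; rewrite /normal_pdf (negbTE s0). Qed.

Lemma normal_pdf_affine (a b x : R) : b != 0%R ->
  (`|b| * normal_pdf a b (a + b * x) = normal_pdf 0 1 x)%R.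
Proof.
move=> b0; rewrite !normal_pdf_nzE ?oner_eq0// mulrA; congr (_ * _)%R.
  rewrite /normal_peak -!mulrnAr sqrtrM ?sqr_ge0// sqrtr_sqr.
  by rewrite expr1n mul1r invfM mulrA divff ?mul1r// normr_eq0.
by rewrite /normal_fun; congr expR; field.
Qed.

(** Completing the square in [a]. In Bayesian terms: likelihood times prior is marginal times
    posterior, and the posterior integrates to 1 over [a]. *)
Lemma normal_pdf_conv (m s b y a : R) : s != 0%R -> b != 0%R ->
  let c := Num.sqrt (s ^+ 2 + b ^+ 2) in
  (normal_pdf a b y * normal_pdf m s a =
   normal_pdf m c y *
     normal_pdf ((m * b ^+ 2 + y * s ^+ 2) / c ^+ 2) (s * b / c) a)%R.
Proof.
move=> s0 b0 c.
have s20 : (0 < s ^+ 2)%R by rewrite exprn_even_gt0.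
have b20 : (0 < b ^+ 2)%R by rewrite exprn_even_gt0.
have c2 : (c ^+ 2 = s ^+ 2 + b ^+ 2)%R by rewrite sqr_sqrtr// addr_ge0// ltW.
have c0 : c != 0%R by rewrite gt_eqF// sqrtr_gt0 addr_gt0.
have sb0 : (s * b / c)%R != 0%R by rewrite mulf_neq0 ?invr_eq0// mulf_neq0.
rewrite !normal_pdf_nzE// mulrACA [RHS]mulrACA; congr (_ * _)%R.
  have pos (x : R) : (0 <= x ^+ 2 * pi *+ 2)%R.
    by rewrite mulrn_wge0// mulr_ge0 ?sqr_ge0 ?pi_ge0.
  rewrite /normal_peak -!invfM -!sqrtrM ?pos//.
  by congr (GRing.inv (Num.sqrt _)); field.
rewrite /normal_fun -!expRD; congr expR.
have c20 : (s ^+ 2 + b ^+ 2 != 0)%R by rewrite gt_eqF// addr_gt0.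
rewrite !exprMn exprVn c2.
by field; rewrite c20 b0 s0.
Qed.

(** Change of variables. A negative [b] is allowed because the density depends on [b] only through
    its square. *)
Lemma normal_prob_affine (a b : R) (B : set R) : b != 0%R -> measurable B ->
  normal_prob 0%R 1%R ((fun x => a + b * x)%R @^-1` B) =
  \int[mu]_(y in B) (normal_pdf a b y)%:E.
Proof.
move=> b0 mB; rewrite /normal_prob.
have mf : measurable_fun setT (fun y => (normal_pdf a b y)%:E).
  by apply/measurable_EFinP; exact: measurable_normal_pdf.
pose f := (fun y => (normal_pdf a b y)%:E) \_ B.
have mfB : measurable_fun setT f.
  by apply/(measurable_restrictT _ _).1 => //; exact: measurable_funTS.
have f0 y : 0 <= f y.
  by rewrite /f patchE; case: ifP => // _; rewrite lee_fin normal_pdf_ge0.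
rewrite [RHS]integral_mkcond -/f -(integral_affine a b0 mfB f0).
have mphi : measurable_fun setT (fun x : measurableTypeR R => (a + b * x)%R : measurableTypeR R).
  by apply: measurable_funD => //; exact: measurable_funM.
rewrite -ge0_integralZl//; last exact: measurableT_comp.
rewrite [LHS]integral_mkcond; apply: eq_integral => x _.
rewrite /f !patchE; have -> : (x \in (fun x => a + b * x)%R @^-1` B) = ((a + b * x)%R \in B).
  by apply/idP/idP; rewrite !inE.
by case: ifP => _; rewrite ?mule0// -EFinM normal_pdf_affine.
Qed.

(** Tonelli exchanges the integrals over [a] and [y]; by [normal_pdf_conv] the inner integral over
    [a] then collapses to the density of the sum. *)
Lemma normal_convolution (m s b : R) (B : set R) : s != 0%R -> b != 0%R ->
  measurable B ->
  \int[normal_prob m s]_a normal_prob 0%R 1%R ((fun x => a + b * x)%R @^-1` B) =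
  normal_prob m (Num.sqrt (s ^+ 2 + b ^+ 2)) B.
Proof.
move=> s0 b0 mB; pose c := Num.sqrt (s ^+ 2 + b ^+ 2).
have pdfM : measurable_fun setT (fun z : R * R => normal_pdf z.1 b z.2).
  under eq_fun do rewrite normal_pdf_nzE//.
  apply: measurable_funM => //; apply: measurableT_comp => //.
  apply: measurable_funM => //; apply: measurableT_comp => //.
  apply: measurable_funX; apply: measurable_funB.
    exact: measurable_snd.
  exact: measurable_fst.
pose F (z : R * R) : \bar R := (normal_pdf z.1 b z.2)%:E * (\1_B z.2)%:E.
have mF : measurable_fun setT F.
  apply: emeasurable_funM; first exact/measurable_EFinP.
  apply/measurable_EFinP; apply: measurableT_comp; last exact: measurable_snd.
  exact: measurable_indic.
have F0 z : 0 <= F z.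
  by rewrite mule_ge0// lee_fin ?normal_pdf_ge0.
transitivity (\int[normal_prob m s]_a \int[mu]_y F (a, y)).
  apply: eq_integral => a _; rewrite normal_prob_affine// integral_mkcond.
  apply: eq_integral => y _; rewrite /F patchE indicE/=.
  by case: ifP => _; rewrite ?mule1 ?mule0.
have FT := fubini_tonelli (m1 := normal_prob m s) (m2 := mu) F mF F0.
etransitivity; first exact: FT.
transitivity (\int[mu]_y ((normal_pdf m c y)%:E * (\1_B y)%:E)).
  apply: eq_integral => y _; rewrite /F/=.
  have mpy : measurable_fun setT (fun a => (normal_pdf a b y)%:E).
    apply/measurable_EFinP.
    under eq_fun do rewrite normal_pdf_nzE//.
    apply: measurable_funM => //; apply: measurableT_comp => //.
    apply: measurable_funM => //; apply: measurableT_comp => //.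
    by apply: measurable_funX; apply: measurable_funB.
  rewrite ge0_integralZr//; last by move=> a _; rewrite lee_fin normal_pdf_ge0.
  congr (_ * _); rewrite integral_normal_prob//; last first.
    (* Integrability: the density is bounded by its peak, and the measure has mass 1. *)
    apply: (@le_lt_trans _ _ (\int[normal_prob m s]_x (normal_peak b)%:E)).
      apply: ge0_le_integral => //.
      - exact: measurableT_comp.
      - move=> x _; rewrite gee0_abs lee_fin ?normal_pdf_ge0//.
        exact: normal_pdf_ub.
    have -> : \int[normal_prob m s]_x (normal_peak b)%:E = (normal_peak b)%:E.
      rewrite integral_cst// -[RHS]mule1; congr (_ * _).
      exact: (@probability_setT _ _ _ (normal_prob m s)).
    exact: ltry.
  under eq_integral do rewrite -EFinM normal_pdf_conv// EFinM.
  rewrite ge0_integralZl//.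
  - by rewrite integral_normal_pdf mule1.
  - by apply/measurable_EFinP; exact: measurable_normal_pdf.
  - by move=> a _; rewrite lee_fin normal_pdf_ge0.
  - by rewrite lee_fin normal_pdf_ge0.
rewrite /normal_prob [RHS]integral_mkcond; apply: eq_integral => y _.
by rewrite patchE indicE; case: ifP => _; rewrite ?mule1 ?mule0.
Qed.
End gaussian.

(** * A Chernoff bound for votes *)

(** Inverting [1 - x <= expR (- x)] leaves [1 <= (1 + x + 2 * x ^+ 2) * (1 - x)], whose right side
    is [1 + x ^+ 2 * (1 - 2 * x)]. *)
Lemma expR_le_quadratic {R : realType} (x : R) : `|x| <= 2^-1 ->
  expR x <= 1 + x + 2 * x ^+ 2.
Proof.
rewrite ler_norml => /andP[x1 x2].
have h : 1 - x <= expR (- x) by exact: expR_ge1Dx.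
have h0 : 0 < 1 - x by lra.
rewrite -[x in expR x]opprK expRN.
apply: (@le_trans _ _ (1 - x)^-1).
  by rewrite lef_pV2 ?posrE ?expR_gt0.
rewrite -[leLHS]mul1r ler_pdivrMr//; nra.
Qed.

Section chernoff.
Context {R : realType} {dT : measure_display} {T : measurableType dT}
        (P : probability T R).

Lemma measure_bigsetU_le (I : Type) (s : seq I) (Q : pred I) (F : I -> set T) :
  (forall i, measurable (F i)) ->
  (P (\big[setU/set0]_(i <- s | Q i) F i) <= \sum_(i <- s | Q i) P (F i))%E.
Proof.
move=> mF; elim: s => [|i s IH]; first by rewrite !big_nil measure0.
rewrite !big_cons; case: ifP => // _.
apply: le_trans (leeD2l _ IH); apply: measureU2 => //.
exact: bigsetU_measurable.
Qed.

(** The event is a finite union of cells, one for each vector of votes with nonnegative sum. *)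
Lemma measurable_ternary_sum (n : nat) (v : 'I_n -> T -> 'I_3) :
  (forall i a, measurable [set t | v i t = a]) ->
  measurable [set t | 0 <= \sum_i ((v i t)%:R - 1 : R)].
Proof.
move=> mv.
pose U (a : {ffun 'I_n -> 'I_3}) := \bigcap_(i in setT) [set t | v i t = a i].
have mU a : measurable (U a).
  by apply: fin_bigcap_measurable => [|i _]; [exact: finite_finset|exact: mv].
rewrite (_ : mkset _ = \big[setU/set0]_(a : {ffun 'I_n -> 'I_3} |
    0 <= \sum_i ((a i)%:R - 1 : R)) U a).
  by apply: bigsetU_measurable => a _; exact: mU.
apply/seteqP; split => t; rewrite -bigcup_seq_cond.
  move=> /= t0; exists [ffun i => v i t]; last by move=> i _; rewrite /= ffunE.
  by rewrite /= mem_index_enum /=; under eq_bigr do rewrite ffunE.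
move=> [a /= /andP[_ a0] Ua].
by under eq_bigr => i do rewrite (Ua i Logic.I).
Qed.

(** The exponential moment method, with expectations written as finite sums over the vectors of
    votes. Each vote contributes a factor at most [1 + 2 * lam ^+ 2 - lam * p i]. *)
Lemma ternary_chernoff (n : nat) (v : 'I_n -> T -> 'I_3) (p : 'I_n -> R) (lam : R) :
  (forall i a, measurable [set t | v i t = a]) ->
  (forall a : 'I_n -> 'I_3,
     P (\bigcap_(i in setT) [set t | v i t = a i]) =
     (\prod_i P [set t | v i t = a i])%E) ->
  (forall i, (P [set t | v i t = 2%N :> nat] + (p i)%:E <=
              P [set t | v i t = 0%N :> nat])%E) ->
  0 <= lam <= 2^-1 ->
  (P [set t | (0 <= \sum_i ((v i t)%:R - 1 : R))%R] <=
   (expR (2 * n%:R * lam ^+ 2 - lam * \sum_i p i))%:E)%E.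
Proof.
move=> mv iv hp /andP[l0 l1].
pose q i a := fine (P [set t | v i t = a]).
have Pq i a : P [set t | v i t = a] = (q i a)%:E.
  by rewrite fineK//; exact: fin_num_measure.
have q0 i a : 0 <= q i a by exact: fine_ge0.
pose val (a : 'I_3) : R := a%:R - 1.
have mI (a : {ffun 'I_n -> 'I_3}) :
    measurable (\bigcap_(i in setT) [set t | v i t = a i]).
  by apply: fin_bigcap_measurable => [|i _]; [exact: finite_finset|exact: mv].
pose U (a : {ffun 'I_n -> 'I_3}) := \bigcap_(i in setT) [set t | v i t = a i].
have subU : [set t | 0 <= \sum_i ((v i t)%:R - 1 : R)] `<=`
    \big[setU/set0]_(a : {ffun 'I_n -> 'I_3} | 0 <= \sum_i val (a i)) U a.
  move=> t /= t0; rewrite -bigcup_seq_cond.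
  exists [ffun i => v i t]; last by move=> i _; rewrite /= ffunE.
  by rewrite /= mem_index_enum /=; under eq_bigr do rewrite ffunE.
have mE := measurable_ternary_sum mv.
have {subU} : (P [set t | (0 <= \sum_i ((v i t)%:R - 1 : R))%R] <=
    \sum_(a : {ffun 'I_n -> 'I_3} | (0 <= \sum_i val (a i))%R) P (U a))%E.
  apply: le_trans (measure_bigsetU_le _ _ _) => //.
  apply: le_measure; rewrite ?inE//.
  by apply: bigsetU_measurable => a _; exact: mI.
move=> /le_trans; apply.
have PU a : P (U a) = (\prod_i q i (a i))%:E.
  by rewrite /U iv -prodEFin; apply: eq_bigr => i _; rewrite Pq.
under eq_bigr do rewrite PU.
rewrite sumEFin lee_fin.
(* Markov's inequality: the indicator of a nonnegative sum is at most the exponential of [lam] times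
   that sum. *)
apply: (@le_trans _ _
    (\sum_(a : {ffun 'I_n -> 'I_3}) \prod_i (q i (a i) * expR (lam * val (a i))))).
  rewrite big_mkcond/=; apply: ler_sum => a _.
  have h0 : 0 <= \prod_i q i (a i) by exact: prodr_ge0.
  case: ifPn => [a0|_]; last by apply: prodr_ge0 => i _; rewrite mulr_ge0 ?expR_ge0.
  rewrite big_split/= ler_peMr// -expR_sum -mulr_sumr -[leLHS]expR0 ler_expR.
  by rewrite mulr_ge0.
(* Distributivity factors the sum over vectors into a product of moment generating functions. *)
rewrite -(bigA_distr_bigA (fun i a => q i a * expR (lam * val a))).
rewrite mulr_sumr -sumrN.
have -> : 2 * n%:R * lam ^+ 2 = \sum_(i < n) (2 * lam ^+ 2).
  by rewrite sumr_const card_ord -mulr_natr; ring.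
rewrite -big_split expR_sum; apply: ler_prod => i _ /=.
apply/andP; split.
  by apply: sumr_ge0 => a _; rewrite mulr_ge0 ?expR_ge0.
pose a0 : 'I_3 := ord0.
pose a1 : 'I_3 := lift ord0 ord0.
pose a2 : 'I_3 := lift ord0 (lift ord0 ord0).
have sum3 (f : 'I_3 -> R) : \sum_a f a = f a0 + f a1 + f a2.
  by rewrite !big_ord_recl big_ord0 addr0 addrA.
have q1 : q i a0 + q i a1 + q i a2 = 1.
  rewrite -sum3; apply: EFin_inj; rewrite -sumEFin.
  under eq_bigr do rewrite -Pq.
  rewrite -(probability_setT P) (_ : setT = \big[setU/set0]_(a : 'I_3) [set t | v i t = a]).
    rewrite measure_bigsetU_ord//.
    apply/trivIsetP => a b _ _ ab; apply/seteqP; split => // t /= [ta tb].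
    by move: ab; rewrite -ta -tb eqxx.
  apply/seteqP; split => // t _; rewrite -bigcup_seq.
  by exists (v i t) => //=; rewrite mem_index_enum.
have qp : q i a2 + p i <= q i a0.
  rewrite -lee_fin EFinD -!Pq.
  have := hp i; congr (_ + _ <= _)%E; congr (P _); apply/seteqP; split => t /=.
  - by move=> h; apply: val_inj.
  - by move=> ->.
  - by move=> h; apply: val_inj.
  - by move=> ->.
rewrite sum3 /val /= subrr sub0r mulr0 expR0.
have lam1 : `|lam| <= 2^-1 by rewrite ger0_norm.
have lam2 : `|- lam| <= 2^-1 by rewrite normrN.
have e1 := expR_le_quadratic lam1; have e2 := expR_le_quadratic lam2.
(* With [q0], [q1], [q2] the three probabilities, the quadratic bounds give at most [1 + lam * (q2 -
   q0) + 2 * lam ^+ 2 * (q0 + q2)]; then [q2 - q0 <= - p i] and [q0 + q2 <= 1]. *)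
apply: (@le_trans _ _ (1 + (2 * lam ^+ 2 - lam * p i))); last exact: expR_ge1Dx.
have -> : 1 *+ bump 0 (bump 0 0) - 1 = 1 :> R by rewrite /bump /=; ring.
rewrite mulrN !mulr1.
have h1 := ler_wpM2l (q0 i a0) e2; have h2 := ler_wpM2l (q0 i a2) e1.
have h3 := ler_wpM2l l0 qp.
have := q0 i a1; have := sqr_ge0 lam; nra.
Qed.

End chernoff.

(** * Medians and hard thresholding *)

(* The next two lemmas include the empty list, whose median is the default 0. *)
Lemma median_gt_count {R : realType} (s : seq R) (r : R) : r < median s ->
  ((count (<= r) s).*2 <= size s)%N.
Proof.
rewrite leqNgt; case: leqP => // h; rewrite /median ltNge => /negP[].
apply: nth_count_le; first exact: sort_le_sorted.
rewrite (permP (permEl (perm_sort _ _))).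
pose c := count (<= r) s; have h' : (size s < c.*2)%N := h.
change ((size s).-1 %/ 2 < c)%N; lia.
Qed.

Lemma median_lt_count {R : realType} (s : seq R) (r : R) : median s < r ->
  (size s <= (count (< r) s).*2)%N.
Proof.
rewrite ltNge [leqRHS]lock leqNgt -lock; case: leqP => // h /negP[]; rewrite /median.
apply: nth_count_ge; first exact: sort_le_sorted.
rewrite (permP (permEl (perm_sort _ _))) size_sort.
pose c := count (< r) s; have h' : (c.*2 < size s)%N := h.
change (c <= (size s).-1 %/ 2 < size s)%N; lia.
Qed.

(** An exact criterion, used for measurability. On the empty list it would fail for [0 <= r],
    because the median is then 0 and the count is 0. *)
Lemma median_leE {R : realType} (s : seq R) (r : R) : (0 < size s)%N ->
  (median s <= r) = ((size s).-1 %/ 2 < count (<= r)%R s)%N.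
Proof.
move=> s0; apply/idP/idP; last first.
  move=> h; apply: nth_count_le; first exact: sort_le_sorted.
  by rewrite (permP (permEl (perm_sort _ _))).
apply: contraTT; rewrite -leqNgt -ltNge => h.
apply: nth_count_gt; first exact: sort_le_sorted.
rewrite (permP (permEl (perm_sort _ _))) size_sort h /=.
by case: (size s) s0 => // m _; rewrite ltnS leq_div.
Qed.

Section hard_threshold_error.
Context {R : realType} (d k : nat).
Implicit Types b beta : 'I_d -> R.

(** The relation counted by [topk_rank]. Breaking ties by index makes it a strict total order, so
    that ranks are distinct. *)
Let ahead b (i j : 'I_d) :=
  (`|b j| < `|b i|) || ((`|b i| == `|b j|) && (val i < val j)%N).

(** By transitivity all that is ahead of [i] is ahead of [j]; the index [i] itself makes the
    inclusion strict. *)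
Lemma topk_rank_lt b i j : ahead b i j -> (topk_rank b i < topk_rank b j)%N.
Proof.
move=> ij; apply/proper_card/properP; split.
  apply/fintype.subsetP => l; rewrite !inE; move: ij.
  case/orP => [h|/andP[/eqP h1 h2]]; case/orP => [h'|/andP[/eqP h1' h2']].
  - by rewrite (lt_trans h h').
  - by rewrite h1' h.
  - by rewrite -h1 h'.
  - by rewrite -h1 -h1' eqxx (ltn_trans h2' h2) orbT.
by exists i; rewrite inE // ltxx ltnn andbF.
Qed.

Lemma topk_rank_inj b : injective (topk_rank b).
Proof.
move=> i j rij; apply/val_inj/eqP.
have [h|h|/eqP h] := ltgtP `|b i| `|b j|.
- by have := @topk_rank_lt b j i; rewrite rij ltnn /ahead h => /(_ isT).
- by have := @topk_rank_lt b i j; rewrite rij ltnn /ahead h => /(_ isT).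
case: (ltngtP (val i) (val j)) => // v.
- by have := @topk_rank_lt b i j; rewrite rij ltnn /ahead h v orbT => /(_ isT).
- have := @topk_rank_lt b j i; rewrite rij ltnn /ahead eq_sym h v orbT.
  by move=> /(_ isT).
Qed.

(** Pigeonhole: the ranks are distinct numbers below [k]. *)
Lemma card_topk b : (#|[set j | in_topk k b j]%SET| <= k)%N.
Proof.
rewrite cardE -(size_map (topk_rank b)) -[leqRHS](size_iota 0).
apply: uniq_leq_size.
  by rewrite map_inj_uniq ?enum_uniq//; exact: topk_rank_inj.
by move=> _ /mapP[j + ->]; rewrite mem_enum inE mem_iota add0n.
Qed.

(** At least [k] indices are ahead of [j]. Were they all in the support of [beta], the support would
    have more than [k] elements, counting [j]. So some [i] ahead of [j] has [beta i = 0], and the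
    modulus of [b j] is at most that of [b i], hence at most [e]. *)
Lemma not_in_topk_le b beta j (e : R) : (#|[set j | beta j != 0%R]%SET| <= k)%N ->
  (forall i, `|beta i - b i| <= e) -> beta j != 0 -> ~~ in_topk k b j ->
  `|b j| <= e.
Proof.
move=> sk he bj0; rewrite /in_topk -leqNgt => krank.
pose A := [set i | ahead b i j]%SET.
pose S := [set j | beta j != 0%R]%SET.
have [/fintype.subsetP AS|/fintype.subsetPn[i]] := boolP (A \subset S).
  have /proper_card : A \proper S.
    apply/properP; split; first exact/fintype.subsetP.
    by exists j; rewrite inE// /ahead ltxx ltnn andbF.
  by rewrite ltnNge (leq_trans sk krank).
rewrite !inE negbK => ij /eqP bi0.
have := he i; rewrite bi0 sub0r normrN; apply: le_trans.
by case/orP: ij => [/ltW//|/andP[/eqP ->]].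
Qed.

(** At most [k] kept coordinates cost [e ^+ 2] each; at most [k] dropped coordinates of the support
    cost [(2 * e) ^+ 2] each; all others cost nothing. *)
Lemma hard_threshold_error b beta (e : R) : 0 <= e ->
  (#|[set j | beta j != 0%R]%SET| <= k)%N ->
  (forall j, `|beta j - b j| <= e) ->
  sqnorm (fun j => beta j - hard_threshold k b j) <= 5 * k%:R * e ^+ 2.
Proof.
move=> e0 sk he; rewrite /sqnorm.
have key j : (beta j - hard_threshold k b j) ^+ 2 <=
    (in_topk k b j)%:R * e ^+ 2 + (beta j != 0)%:R * (4 * e ^+ 2).
  rewrite /hard_threshold -real_normK ?num_real//.
  have e20 : 0 <= e ^+ 2 by rewrite sqr_ge0.
  case: ifPn => [_|jk].
    rewrite mul1r (@le_trans _ _ (e ^+ 2))//.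
      by rewrite lerXn2r ?nnegrE.
    by rewrite lerDl mulr_ge0// mulr_ge0.
  rewrite mul0r add0r subr0; have [->|bj0] := eqVneq (beta j) 0.
    by rewrite normr0 expr0n mul0r.
  rewrite mul1r (_ : 4 * e ^+ 2 = (2 * e) ^+ 2); last by ring.
  rewrite lerXn2r ?nnegrE ?mulr_ge0//.
  have := not_in_topk_le sk he bj0 jk; have := he j.
  have := ler_normD (beta j - b j) (b j); rewrite subrK; lra.
apply: le_trans (ler_sum _ (fun j _ => key j)) _.
rewrite big_split/= -!mulr_suml -!natr_sum.
have -> : (\sum_(j < d) in_topk k b j = #|[set j | in_topk k b j]%SET|)%N.
  rewrite -sum1_card [RHS]big_mkcond; apply: eq_bigr => j _ /=.
  by rewrite inE; case: ifP.
have -> : (\sum_(j < d) (beta j != 0%R) = #|[set j | beta j != 0%R]%SET|)%N.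
  rewrite -sum1_card [RHS]big_mkcond; apply: eq_bigr => j _ /=.
  by rewrite inE; case: ifP.
have h1 : (#|[set j | in_topk k b j]%SET|)%:R <= k%:R :> R.
  by rewrite ler_nat card_topk.
have h2 : (#|[set j | beta j != 0%R]%SET|)%:R <= k%:R :> R by rewrite ler_nat.
have e20 : 0 <= e ^+ 2 by rewrite sqr_ge0.
have := ler_wpM2r e20 h1; have := ler_wpM2r e20 h2; nra.
Qed.

End hard_threshold_error.

(** * Gaussian estimates *)

Section normal_bounds.
Context {R : realType}.

(** Length of the interval times a lower bound of the density on it; the factor 3 bounds the square
    root of [2 * pi]. *)
Lemma normal_prob_ge (a v e l r : R) : 0 < v -> l <= r ->
  (forall x, l <= x <= r -> (x - a) ^+ 2 <= e * v ^+ 2) ->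
  (((r - l) / (3 * v) * expR (- (e / 2)))%:E <=
   normal_prob a v `[l, r]%classic)%E.
Proof.
move=> v0 lr h; have vn0 : v != 0 by rewrite gt_eqF.
have v20 : 0 < v ^+ 2 by rewrite exprn_gt0.
have pk : (3 * v)^-1 <= normal_peak v.
  rewrite /normal_peak lef_pV2 ?posrE ?mulr_gt0//; last first.
    by rewrite sqrtr_gt0 -mulr_natr !mulr_gt0 ?pi_gt0.
  rewrite -(ger0_norm (ltW (mulr_gt0 _ v0)))// -sqrtr_sqr ler_wsqrtr//.
  have pi4 : pi < 4 :> R by move: (@pihalf_lt2 R); lra.
  by rewrite -mulr_natr; nra.
rewrite /normal_prob.
apply: (@le_trans _ _ (\int[lebesgue_measure]_(x in `[l, r]%classic)
    ((3 * v)^-1 * expR (- (e / 2)))%:E)%E).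
  rewrite integral_cst//= lebesgue_measure_itv/= lte_fin.
  case: ltP => [_|rl].
    by rewrite -EFinB -EFinM lee_fin le_eqVlt; apply/orP; left; apply/eqP; ring.
  by rewrite (_ : l = r) ?subrr ?mul0r ?mule0//; apply/eqP; rewrite eq_le lr.
apply: ge0_le_integral => //=.
- by move=> x _; rewrite lee_fin mulr_ge0 ?expR_ge0// invr_ge0 mulr_ge0// ltW.
- by apply/measurable_EFinP/measurable_funTS; exact: measurable_normal_pdf.
- move=> x; rewrite in_itv/= => xlr; rewrite lee_fin normal_pdf_nzE//.
  apply: ler_pM; rewrite ?expR_ge0// ?invr_ge0 ?mulr_ge0 ?(ltW v0)//.
  rewrite /normal_fun ler_expR mulNr lerN2 -mulr_natr ler_pdivrMr ?mulr_gt0//.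
  have := h x xlr; rewrite le_eqVlt => /orP[/eqP ->|]; nra.
Qed.

(** The interval from 1/2 to 1 suffices: its length over 3 is 1/6, and the exponential factor is at
    least 1/2. *)
Lemma normal_prob_std_tail :
  ((12^-1)%:E <= normal_prob 0%R 1%R [set x : R | (2^-1 <= `|x|)%R])%E.
Proof.
have e0 : (2^-1 : R) <= expR (- (1 / 2)).
  by apply: le_trans (expR_ge1Dx _); lra.
apply: (@le_trans _ _ (normal_prob 0 1 `[2^-1 : R, 1]%classic)).
  apply: le_trans (@normal_prob_ge 0 1 1 2^-1 1 ltr01 _ _).
  - by rewrite lee_fin; nra.
  - lra.
  - by move=> x /andP[x1 x2]; rewrite subr0; nra.
apply: le_measure; rewrite ?inE//.
  rewrite -[X in measurable X]setTI; exact: measurable_fun_ler.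
move=> x /=; rewrite in_itv/= => /andP[x1 x2].
by rewrite ger0_norm//; lra.
Qed.

(** Points of the ball are within [2 * v] of the mean, so the exponential factor is at least
    [expR (- 2)], which is at least 1/16; and 2/3 times 1/16 is 1/24. *)
Lemma normal_prob_ball (a v dl : R) : 1 <= v -> `|a| <= 1 -> 0 <= dl <= 1 ->
  ((dl / 24)%:E <= normal_prob a v [set x : R | `|x| <= dl * v]%R)%E.
Proof.
move=> v1 a1 /andP[d0 d1].
have -> : [set x : R | `|x| <= dl * v] = `[(- (dl * v)), (dl * v)]%classic.
  by apply/seteqP; split => x /=; rewrite in_itv/= ler_norml.
have v0 : 0 < v by lra.
have dv : 0 <= dl * v by rewrite mulr_ge0// ltW.
have h := @normal_prob_ge a v 4 (- (dl * v)) (dl * v) v0.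
apply: le_trans (h _ _); last 2 first.
- lra.
- move=> x; rewrite -ler_norml => xd.
  have xa : `|x - a| <= 2 * v.
    apply: (le_trans (ler_normB _ _)); nra.
  rewrite -(@real_normK _ (x - a)) ?num_real// (_ : 4 * v ^+ 2 = (2 * v) ^+ 2); last by ring.
  by rewrite lerXn2r ?nnegrE ?mulr_ge0// ltW.
rewrite lee_fin.
have e1 : (2^-1 : R) <= expR (- (1 / 2)).
  by apply: le_trans (expR_ge1Dx _); lra.
have e2 : (2^-1 : R) ^+ 4 <= expR (- (4 / 2)).
  rewrite (_ : - (4 / 2) = 4%:R * (- (1 / 2)) :> R); last by field.
  by rewrite expRM_natl lerXn2r ?nnegrE ?expR_ge0.
have -> : (dl * v - - (dl * v)) / (3 * v) = 2 / 3 * dl by field; rewrite gt_eqF.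
apply: (@le_trans _ _ (2 / 3 * dl * 2^-1 ^+ 4)); first lra.
by rewrite ler_wpM2l// mulr_ge0.
Qed.

Lemma normal_prob_opp (B : set R) : measurable B ->
  normal_prob 0 1 (-%R @^-1` B) = normal_prob 0 1 B.
Proof.
move=> mB; rewrite (_ : -%R @^-1` B = (fun x => 0 + (-1) * x) @^-1` B).
  rewrite normal_prob_affine// ?oppr_eq0 ?oner_eq0//.
  rewrite /normal_prob; apply: eq_integral => x _.
  rewrite !normal_pdf_nzE ?oppr_eq0 ?oner_eq0//.
  by rewrite /normal_peak /normal_fun sqrrN.
by apply/seteqP; split => x /=; rewrite add0r mulN1r.
Qed.

Lemma normal_prob_shift (a : R) (B : set R) : measurable B ->
  normal_prob 0 1 ((fun x => a + x) @^-1` B) = normal_prob a 1 B.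
Proof.
move=> mB; rewrite (_ : _ @^-1` B = (fun x => a + 1 * x) @^-1` B).
  by rewrite normal_prob_affine ?oner_eq0.
by apply/seteqP; split => x /=; rewrite mul1r.
Qed.

End normal_bounds.

Lemma set_andb (U : Type) (a b : U -> bool) :
  [set x | a x && b x] = [set x | a x] `&` [set x | b x].
Proof. by apply/seteqP; split => x /=; [move/andP|case=> -> ->]. Qed.

Lemma ratio_small (R : realType) (x y e : R) : 0 <= e -> x <= e / 2 ->
  2^-1 <= y -> x * y <= e * y ^+ 2.
Proof.
move=> e0 hx hy; have y0 : 0 <= y by lra.
have h1 := ler_wpM2r y0 hx.
have h2 : 0 <= e * y * (y - 2^-1) by rewrite !mulr_ge0// subr_ge0.
by lra.
Qed.

(** * Measurability of events defined by comparisons *)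

Section measurable_comparison.
Context {R : realType} {d : measure_display} {T : measurableType d}.
Implicit Types a b : T -> R.

Lemma measurable_set_le a b : measurable_fun setT a -> measurable_fun setT b ->
  measurable [set t | a t <= b t].
Proof. by move=> ma mb; rewrite -[X in measurable X]setTI; exact: measurable_fun_ler. Qed.

Lemma measurable_set_lt a b : measurable_fun setT a -> measurable_fun setT b ->
  measurable [set t | a t < b t].
Proof. by move=> ma mb; rewrite -[X in measurable X]setTI; exact: measurable_fun_ltr. Qed.

Lemma measurable_norm_ge a (e : R) : measurable_fun setT a ->
  measurable [set t | e <= `|a t|].
Proof. by move=> ma; apply: measurable_set_le => //; exact: measurableT_comp. Qed.

Lemma measurable_norm_le a (e : R) : measurable_fun setT a ->
  measurable [set t | `|a t| <= e].
Proof. by move=> ma; apply: measurable_set_le => //; exact: measurableT_comp. Qed.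

Lemma measurable_bias_gt a b (c e k : R) :
  measurable_fun setT a -> measurable_fun setT b ->
  measurable [set t | (c <= `|b t|) && (e * b t ^+ 2 < k * a t * b t)].
Proof.
move=> ma mb; rewrite set_andb; apply: measurableI; first exact: measurable_norm_ge.
apply: measurable_set_lt; first by apply: measurable_funM => //; exact: measurable_funX.
by apply: measurable_funM => //; exact: measurable_funM.
Qed.

Lemma measurable_bias_le a b (c e k : R) :
  measurable_fun setT a -> measurable_fun setT b ->
  measurable [set t | (c <= `|b t|) && (k * a t * b t <= e * b t ^+ 2)].
Proof.
move=> ma mb; rewrite set_andb; apply: measurableI; first exact: measurable_norm_ge.
apply: measurable_set_le; last by apply: measurable_funM => //; exact: measurable_funX.
by apply: measurable_funM => //; exact: measurable_funM.
Qed.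

End measurable_comparison.

(** * Joint laws of independent pairs and the symmetry of their ratio *)

Section pairs.
Context {R : realType} {dT : measure_display} {T : measurableType dT}
        (P : probability T R).

Definition normal_law (Z : T -> R) (m s : R) :=
  forall B : set R, measurable B -> P (Z @^-1` B) = normal_prob m s B.

Definition indep_pair (f g : T -> R) := forall A B, measurable A -> measurable B ->
  P (f @^-1` A `&` g @^-1` B) = (P (f @^-1` A) * P (g @^-1` B))%E.

(** The pushforward along the pair agrees with the product measure on rectangles, which determine
    it. *)
Lemma joint_law (f g : T -> measurableTypeR R)
    (m1 m2 : probability (measurableTypeR R) R) :
  measurable_fun setT f -> measurable_fun setT g ->
  indep_pair f g ->
  (forall B, measurable B -> P (f @^-1` B) = m1 B) ->
  (forall B, measurable B -> P (g @^-1` B) = m2 B) ->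
  forall C : set (measurableTypeR R * measurableTypeR R), measurable C ->
  P [set t | C (f t, g t)] = (m1 \x m2)%E C.
Proof.
move=> mf mg ifg fE gE C mC.
have [m' m'E] := measure_pushforward P (measurable_fun_pair mf mg).
have m'X A B : measurable A -> measurable B -> m' (A `*` B) = (m1 A * m2 B)%E.
  by move=> mA mB; rewrite m'E -fE// -gE// -ifg.
transitivity (m' C); first by rewrite m'E.
exact/esym/(product_measure_unique m'X).
Qed.

Lemma normal_law_opp g : normal_law g 0 1 -> normal_law (fun t => - g t) 0 1.
Proof.
move=> gE B mB; rewrite -normal_prob_opp// -gE//.
by rewrite -[X in measurable X]setTI; exact: oppr_measurable.
Qed.

Lemma normal_law_add (f g : T -> R) (m s b : R) : 0 < s ->
  measurable_fun setT f -> measurable_fun setT g -> indep_pair f g ->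
  normal_law f m s -> normal_law g 0 1 ->
  normal_law (fun t => f t + b * g t) m (Num.sqrt (s ^+ 2 + b ^+ 2)).
Proof.
move=> s0 mf mg ifg fE gE B mB.
(* The convolution formula needs a nondegenerate second term. *)
have [->|b0] := eqVneq b 0.
  rewrite expr0n addr0 sqrtr_sqr gtr0_norm// -fE//; congr (P _).
  by apply/seteqP; split => t /=; rewrite mul0r addr0.
pose C := [set z : R * R | B (z.1 + b * z.2)].
have mC : measurable C.
  rewrite -[X in measurable X]setTI.
  suff mh : measurable_fun setT (fun z : R * R => z.1 + b * z.2) by exact: mh.
  apply: measurable_funD; first exact: measurable_fst.
  by apply: measurable_funM => //; exact: measurable_snd.
transitivity (P [set t | C (f t, g t)]) => //.
rewrite (@joint_law f g (normal_prob m s) (normal_prob 0 1) mf mg ifg fE gE _ mC).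
transitivity (\int[normal_prob m s]_a normal_prob 0%R 1%R (xsection C a))%E => //.
have sn0 : s != 0 by rewrite gt_eqF.
rewrite -(normal_convolution m sn0 b0 mB); apply: eq_integral => a _.
congr (normal_prob _ _ _); apply/seteqP; split => x.
  by rewrite /xsection /= inE.
by rewrite /xsection /= inE.
Qed.

Lemma indep_pair_opp (f g : T -> R) : indep_pair f g -> indep_pair f (fun t => - g t).
Proof.
move=> ifg A B mA mB; have := ifg A (-%R @^-1` B) mA; apply.
by rewrite -[X in measurable X]setTI; exact: oppr_measurable.
Qed.

Lemma joint_law_opp (f g : T -> R) (m s : R) :
  measurable_fun setT f -> measurable_fun setT g -> indep_pair f g ->
  normal_law f m s -> normal_law g 0 1 ->
  forall C : set (R * R), measurable C ->
  P [set t | C (f t, g t)] = P [set t | C (f t, - g t)].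
Proof.
move=> mf mg ifg fE gE C mC.
rewrite (@joint_law f g (normal_prob m s) (normal_prob 0 1) mf mg ifg fE gE _ mC).
rewrite (@joint_law f (fun t => - g t) (normal_prob m s) (normal_prob 0 1) mf _ _ fE _ _ mC)//.
- exact: measurableT_comp.
- exact: indep_pair_opp.
- exact: normal_law_opp.
Qed.

(* Flipping the sign of [g] exchanges the two tails of [f / g]; the comparisons of
   [k * f / g] with [e] are multiplied through by [g ^+ 2]. *)
Lemma ratio_bias (f g : T -> R) (m s e k : R) :
  measurable_fun setT f -> measurable_fun setT g -> indep_pair f g ->
  normal_law f m s -> normal_law g 0 1 -> 0 <= e -> k = 1 \/ k = -1 ->
  (P [set t | (2^-1 <= `|g t|) && (e * g t ^+ 2 < k * f t * g t)]%R +
   P [set t | `|f t| <= e / 2]%R * P [set t | 2^-1 <= `|g t|]%R <=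
   P [set t | (2^-1 <= `|g t|) && (k * f t * g t <= e * g t ^+ 2)]%R)%E.
Proof.
move=> mf mg ifg fE gE e0 k1.
pose C := [set z : R * R | (2^-1 <= `|z.2|) && (e * z.2 ^+ 2 < k * z.1 * z.2)].
have mC : measurable C.
  by apply: measurable_bias_gt; [exact: measurable_fst|exact: measurable_snd].
have mng : measurable_fun setT (fun t => - g t) by exact: measurableT_comp.
have := @joint_law_opp f g m s mf mg ifg fE gE C mC.
rewrite {1}/C /= => ->.
have -> : (P [set t | (`|f t| <= e / 2)%R] * P [set t | (2^-1 <= `|g t|)%R])%E =
    P ([set t | `|f t| <= e / 2] `&` [set t | 2^-1 <= `|g t|]).
  apply/esym.
  have mA (c : R) : measurable [set x : R | `|x| <= c] by exact: measurable_norm_le.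
  have mB (c : R) : measurable [set x : R | c <= `|x|] by exact: measurable_norm_ge.
  exact: ifg (mA (e / 2)) (mB 2^-1).
(* After the flip, the two events on the left are disjoint and contained in the right one: the first
   has [k * f * g < - (e * g ^+ 2)], while on the second [k * f * g] is at most [e * g ^+ 2] in
   absolute value. *)
rewrite -measureU.
- apply: le_measure; rewrite ?inE.
  + apply: measurableU; first exact: measurable_bias_gt.
    by apply: measurableI; [exact: measurable_norm_le|exact: measurable_norm_ge].
  + exact: measurable_bias_le.
  + move=> t /= [/andP[]|[]].
      rewrite normrN => -> /=; rewrite sqrrN mulrN => h.
      have := sqr_ge0 (g t); nra.
    move=> h1 h2; rewrite h2 /=.
    apply: le_trans (ler_norm _) _; rewrite normrM.
    rewrite -[g t ^+ 2]real_normK ?num_real//.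
    have -> : `|k * f t| = `|f t|.
      by rewrite normrM; case: k1 => ->; rewrite ?normrN normr1 mul1r.
    exact: ratio_small.
- exact: measurable_bias_gt.
- by apply: measurableI; [exact: measurable_norm_le|exact: measurable_norm_ge].
- apply/seteqP; split => // t /= [/andP[]]; rewrite normrN sqrrN mulrN => h1 h2 [h3 _].
  have : `|k * f t * g t| <= e * `|g t| ^+ 2.
    rewrite normrM.
    have -> : `|k * f t| = `|f t|.
      by rewrite normrM; case: k1 => ->; rewrite ?normrN normr1 mul1r.
    exact: ratio_small.
  rewrite real_normK ?num_real// ler_norml => /andP[h4 h5].
  by move: h2 => /=; lra.
Qed.

End pairs.

(** * Linear combinations of independent Gaussian variables *)

Section sums.
Context {R : realType} {d : measure_display} {T : measurableType d}.

(** Measurability is asked only on [s]: the lemma is applied to the sigma-algebra of one block, for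
    which variables outside the block may fail to be measurable. *)
Lemma measurable_sum_in (I : eqType) (s : seq I) (h : I -> T -> R) :
  (forall i, i \in s -> measurable_fun setT (h i)) ->
  measurable_fun setT (fun t => \sum_(i <- s) h i t).
Proof.
elim: s => [|i s IH] hs.
  by under eq_fun do rewrite big_nil; exact: measurable_cst.
under eq_fun do rewrite big_cons; apply: measurable_funD.
  by apply: hs; rewrite mem_head.
by apply: IH => l ls; apply: hs; rewrite inE ls orbT.
Qed.

End sums.

Section gaussian_combinations.
Context {R : realType} {dT : measure_display} {T : measurableType dT}
        (P : probability T R).

(** Conditioning on the sign: each value of [g] contributes half of the same normal probability, by
    symmetry of [w]. *)
Lemma rademacher_mul_law (c : R) (g w : T -> R) : indep_pair P g w ->
  rademacher P g -> measurable_fun setT w -> normal_law P w 0 1 ->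
  normal_law P (fun t => c + g t * w t) c 1.
Proof.
move=> igw [mg [g1 [gp gm]]] mw wE B mB.
pose B1 := (fun x => c + x) @^-1` B.
have mB1 : measurable B1.
  by rewrite -[X in measurable X]setTI; apply: measurable_funD.
have mB2 : measurable (-%R @^-1` B1).
  by rewrite -[X in measurable X]setTI; exact: oppr_measurable.
have -> : (fun t => c + g t * w t) @^-1` B =
    (g @^-1` [set 1] `&` w @^-1` B1) `|` (g @^-1` [set -1] `&` w @^-1` (-%R @^-1` B1)).
  apply/seteqP; split => t /=.
    case: (g1 t) => gt; rewrite gt; first by rewrite mul1r => Bt; left.
    by rewrite mulN1r => Bt; right.
  by case=> [[-> /=]|[-> /=]]; rewrite ?mul1r ?mulN1r.
have mpre (h : T -> R) A : measurable_fun setT h -> measurable A -> measurable (h @^-1` A).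
  by move=> mh mA; rewrite -[X in measurable X]setTI; exact: mh.
have m1 (x : R) : measurable [set x] by exact: measurable_set1.
have e1 : P (g @^-1` [set 1] `&` w @^-1` B1) = ((2^-1)%:E * normal_prob 0%R 1%R B1)%E.
  by rewrite igw// gp wE.
have e2 : P (g @^-1` [set -1] `&` w @^-1` (-%R @^-1` B1)) =
    ((2^-1)%:E * normal_prob 0%R 1%R B1)%E.
  by rewrite igw// gm wE// normal_prob_opp.
pose A1 := g @^-1` [set 1] `&` w @^-1` B1.
pose A2 := g @^-1` [set -1] `&` w @^-1` (-%R @^-1` B1).
transitivity (P A1 + P A2)%E.
  apply: measureU; try (by apply: measurableI; exact: mpre).
  apply/seteqP; split => // t /= [[-> _] [/eqP]].
  by rewrite -subr_eq0 opprK (_ : 1 + 1 = 2%:R :> R)// pnatr_eq0.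
rewrite /A1 /A2 e1 e2 -ge0_muleDl ?lee_fin//.
by rewrite -EFinD (_ : 2^-1 + 2^-1 = 1 :> R) ?mul1e ?normal_prob_shift//; field.
Qed.

Context {I : finType} (Z : I -> T -> R).
Context (mZ : forall i, measurable_fun setT (Z i))
        (iZ : mutually_independent P Z).

(** The terms are added one at a time with [normal_law_add]. The last hypothesis says that [f] is a
    function of the variables other than [Z l]; with [uniq s] it makes each partial sum independent
    of the next variable. *)
Lemma lincomb_normal_law (f : T -> R) (m v : R) (b : I -> R) (s : seq I) :
  uniq s -> 0 < v -> normal_law P f m v ->
  (forall l, l \in s -> normal_law P (Z l) 0 1) ->
  measurable_fun setT f ->
  (forall l, l \in s ->
    measurable_fun setT (f : g_sigma_algebraType (block_sys Z (fun a => a == l) false) -> R)) ->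
  normal_law P (fun t => f t + \sum_(l <- s) b l * Z l t) m
    (Num.sqrt (v ^+ 2 + \sum_(l <- s) b l ^+ 2)).
Proof.
move=> us v0 fE + mf.
elim: s us => [_ _ _|l0 s IH /= /andP[l0s us] sE sf].
  rewrite big_nil addr0 sqrtr_sqr gtr0_norm// => B mB.
  by rewrite -fE//; congr (P _); apply/seteqP; split => t /=; rewrite big_nil addr0.
pose g t := f t + \sum_(l <- s) b l * Z l t.
have gE : normal_law P g m (Num.sqrt (v ^+ 2 + \sum_(l <- s) b l ^+ 2)).
  apply: IH => // l ls; first by apply: sE; rewrite inE ls orbT.
  by apply: sf; rewrite inE ls orbT.
have A0 : 0 < v ^+ 2 + \sum_(l <- s) b l ^+ 2.
  by rewrite ltr_pwDl ?exprn_gt0// sumr_ge0// => l _; rewrite sqr_ge0.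
have mg : measurable_fun setT g.
  apply: measurable_funD => //; apply: measurable_sum_in => l _.
  exact: measurable_funM.
pose blk (a : I) := a == l0.
have ig : indep_pair P g (Z l0).
  apply: (@indep_block_pair _ _ _ P _ _ Z blk mZ iZ _ _ _ _ false true) => //.
    apply: measurable_funD; first by apply: sf; rewrite mem_head.
    apply: measurable_sum_in => l ls; apply: measurable_funM => //.
    apply: measurable_in_block; apply/negbTE.
    by apply: contraNneq l0s => <-.
  by apply: measurable_in_block; exact: eqxx.
have s0 : 0 < Num.sqrt (v ^+ 2 + \sum_(l <- s) b l ^+ 2) by rewrite sqrtr_gt0.
have := @normal_law_add _ _ _ P g (Z l0) m _ (b l0) s0 mg (mZ l0) ig gE (sE l0 (mem_head _ _)).
rewrite sqr_sqrtr ?(ltW A0)// big_cons => h.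
have -> : v ^+ 2 + (b l0 ^+ 2 + \sum_(l <- s) b l ^+ 2) =
  v ^+ 2 + \sum_(l <- s) b l ^+ 2 + b l0 ^+ 2 by rewrite -addrA [_ + b l0 ^+ 2]addrC.
move=> B mB; rewrite -h//; congr (P _); apply/seteqP; split => t /=;
  by rewrite /g big_cons -addrA [_ + b l0 * _]addrC.
Qed.

End gaussian_combinations.

(** * Measurability of the estimator *)

(* [P] is unspecified on non-measurable sets, so the event of the theorem has to be
   shown measurable. *)
Section estimator_measurability.
Context {R : realType} {d : measure_display} {T : measurableType d}.

Lemma measurable_natr (b : T -> bool) : measurable [set t | b t] ->
  measurable_fun setT (fun t => (b t)%:R : R).
Proof.
move=> mb; rewrite (_ : (fun _ => _) = \1_[set t | b t]); first exact: measurable_indic.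
apply/funext => t; rewrite indicE; have -> // : (t \in [set t | b t]) = b t.
by apply/idP/idP; rewrite inE.
Qed.

Lemma measurable_natr_sum (I : finType) (b : I -> T -> bool) :
  (forall i, measurable [set t | b i t]) ->
  measurable_fun setT (fun t => (\sum_i (b i t : nat))%N%:R : R).
Proof.
move=> mb; under eq_fun do rewrite natr_sum.
by apply: measurable_sum => i; exact: measurable_natr.
Qed.

Lemma size_filter_enum n (b : 'I_n -> bool) (f : 'I_n -> R) :
  size [seq f i | i <- enum 'I_n & b i] = (\sum_i (b i : nat))%N.
Proof.
rewrite size_map size_filter -sum1_count big_enum_cond/= big_mkcond/=.
by apply: eq_bigr => i _; case: (b i).
Qed.

Lemma count_filter_enum n (b : 'I_n -> bool) (f : 'I_n -> R) (p : pred R) :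
  count p [seq f i | i <- enum 'I_n & b i] = (\sum_i (b i && p (f i) : nat))%N.
Proof.
rewrite count_map count_filter -sum1_count big_enum_cond/= big_mkcond/=.
by apply: eq_bigr => i _; rewrite andbC; case: (b i && _).
Qed.

(** The event that the median is at most [r] depends only on two counts: the size [N] of the list
    and the number [K] of its entries at most [r]. For [0 < N] the condition is [N <= 2 * K]. *)
Lemma measurable_median n (f : 'I_n -> T -> R) (b : 'I_n -> T -> bool) :
  (forall i, measurable [set t | b i t]) ->
  (forall i r, measurable [set t | b i t && (f i t <= r)]) ->
  measurable_fun setT (fun t => median [seq f i t | i <- enum 'I_n & b i t]).
Proof.
move=> mb mfb.
apply: (measurability (@RGenOInfty.G R)); first exact: RGenOInfty.measurableE.
move=> _ [_ [r ->] <-]; rewrite setTI.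
pose N t := (\sum_i (b i t : nat))%N.
pose K t := (\sum_i (b i t && (f i t <= r)%R : nat))%N.
have mN : measurable_fun setT (fun t => (N t)%:R : R) by exact: measurable_natr_sum.
have mK : measurable_fun setT (fun t => (K t)%:R : R) by exact: measurable_natr_sum.
rewrite (_ : _ @^-1` _ = ~` (([set t | (N t)%:R <= 0 :> R] `&` [set _ | 0 <= r]) `|`
   ([set t | (0 : R) < (N t)%:R] `&` [set t | (N t)%:R <= 2 * (K t)%:R :> R]))).
  apply: measurableC; apply: measurableU; apply: measurableI.
  - exact: measurable_set_le.
  - exact: measurable_set_le.
  - exact: measurable_set_lt.
  - by apply: measurable_set_le => //; exact: measurable_funM.
suff H t : (median [seq f i t | i <- enum 'I_n & b i t] <= r) =
    (N t == 0)%N && (0 <= r) || (0 < N t)%N && (N t <= 2 * K t)%N.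
  apply/seteqP; split => t /=.
    rewrite in_itv/= andbT ltNge H => /negP h h2; apply: h.
    case: h2 => [[h1 h2]|[h1 h2]].
      by move: h1; rewrite (ler_nat _ _ 0) leqn0 => ->; rewrite h2.
    by move: h1 h2; rewrite ltr0n -natrM ler_nat => -> ->; rewrite orbT.
  move=> h; rewrite in_itv/= andbT ltNge H; apply/negP => /orP[]/andP[h1 h2]; apply: h.
    by left; split => //; rewrite (eqP h1).
  by right; rewrite ltr0n -natrM ler_nat.
(* On an empty list the median is the default 0, so the condition becomes [0 <= r]. *)
have [N0|N0] := posnP (N t).
  rewrite /= orbF.
  have /size0nil -> : size [seq f i t | i <- enum 'I_n & b i t] = 0%N.
    by rewrite size_filter_enum.
  by rewrite /median nth_nil.
rewrite median_leE ?size_filter_enum// count_filter_enum -/(N t) -/(K t).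
rewrite /=; lia.
Qed.

Lemma measurable_hard_threshold p k (b : T -> 'I_p -> R) :
  (forall j, measurable_fun setT (b ^~ j)) ->
  forall j, measurable_fun setT (fun t => hard_threshold k (b t) j).
Proof.
move=> mb j.
pose a (i : 'I_p) t := (`|b t j| < `|b t i|) || ((`|b t i| == `|b t j|) && (val i < val j)%N).
have ma i : measurable [set t | a i t].
  have -> : [set t | a i t] = [set t | `|b t j| < `|b t i|] `|`
     (([set t | `|b t i| <= `|b t j|] `&` [set t | `|b t j| <= `|b t i|]) `&`
      [set _ | (val i < val j)%N]).
    apply/seteqP; split => t /=.
      by case/orP => [->|/andP[/eqP -> ->]]; [left|right; rewrite lexx].
    rewrite /a; case=> [->//|[[h1 h2] ->]].
    by apply/orP; right; rewrite andbT eq_le h1.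
  have mn l : measurable_fun setT (fun t => `|b t l|) by exact: measurableT_comp.
  apply: measurableU; first exact: measurable_set_lt.
  apply: measurableI; first by apply: measurableI; exact: measurable_set_le.
  by case: (val i < val j)%N; rewrite ?set_true ?set_false.
have rankE t : topk_rank (b t) j = (\sum_i (a i t : nat))%N.
  rewrite /topk_rank -sum1_card [LHS]big_mkcond; apply: eq_bigr => i _ /=.
  by rewrite inE -/(a i t); case: (a i t).
have mT : measurable [set t | in_topk k (b t) j].
  have -> : [set t | in_topk k (b t) j] =
      [set t | ((\sum_i (a i t : nat))%N%:R : R) < k%:R].
    by apply/seteqP; split => t /=; rewrite ltr_nat -rankE.
  by apply: measurable_set_lt => //; exact: measurable_natr_sum.
rewrite (_ : (fun _ => _) = (fun t => (in_topk k (b t) j)%:R * b t j)).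
  by apply: measurable_funM => //; exact: measurable_natr.
by apply/funext => t; rewrite /hard_threshold; case: ifP; rewrite ?mul1r ?mul0r.
Qed.

(** Multiplying by [x ^+ 2] rather than [x] preserves the inequality whatever the sign of [x]. *)
Lemma le_div_mul (x y r : R) : 0 < `|x| -> (y / x <= r) = (y * x <= r * x ^+ 2).
Proof.
rewrite normr_gt0 => x0; have x2 : 0 < x ^+ 2 by rewrite exprn_even_gt0.
by rewrite -(ler_pM2r x2) (_ : y / x * x ^+ 2 = y * x)//; field.
Qed.

Lemma lt_div_mul (x y r : R) : 0 < `|x| -> (y / x < r) = (y * x < r * x ^+ 2).
Proof.
rewrite normr_gt0 => x0; have x2 : 0 < x ^+ 2 by rewrite exprn_even_gt0.
by rewrite -(ltr_pM2r x2) (_ : y / x * x ^+ 2 = y * x)//; field.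
Qed.

Lemma measurable_cm_beta' n p (sg w y : 'I_n -> T -> R) (X : 'I_n -> 'I_p -> T -> R) :
  (forall i, measurable_fun setT (sg i)) -> (forall i, measurable_fun setT (w i)) ->
  (forall i, measurable_fun setT (y i)) ->
  (forall i j, measurable_fun setT (X i j)) ->
  forall j, measurable_fun setT (fun t =>
    cm_beta' (sg ^~ t) (w ^~ t) (y ^~ t) (fun i j => X i j t) j).
Proof.
move=> msg mw my mX j; rewrite /cm_beta'.
have mx' i : measurable_fun setT (fun t => sg i t * X i j t) by exact: measurable_funM.
have my' i : measurable_fun setT (fun t => sg i t * y i t + w i t).
  by apply: measurable_funD => //; exact: measurable_funM.
apply: (@measurable_median n (fun i t => (sg i t * y i t + w i t) / (sg i t * X i j t))
  (fun i t => 2^-1 <= `|sg i t * X i j t|)) => i; first exact: measurable_norm_ge.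
move=> r.
rewrite (_ : mkset _ = [set t | 2^-1 <= `|sg i t * X i j t|] `&`
  [set t | (sg i t * y i t + w i t) * (sg i t * X i j t) <= r * (sg i t * X i j t) ^+ 2]).
  apply: measurableI; first exact: measurable_norm_ge.
  by apply: measurable_set_le; apply: measurable_funM => //; exact: measurable_funX.
have x0 t : 2^-1 <= `|sg i t * X i j t| -> 0 < `|sg i t * X i j t|.
  by apply: lt_le_trans; rewrite invr_gt0.
apply/seteqP; split => t /=.
  by move=> /andP[h]; rewrite le_div_mul ?x0.
by move=> [h]; rewrite -le_div_mul ?x0// h.
Qed.

End estimator_measurability.

(** * Votes on the median of one coordinate *)

Section vote.
Context {R : realType}.
Implicit Types k e z x : R.

(* The values 0, 1, 2 of a vote stand for -1, 0, +1. *)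
Definition vote k e z x : 'I_3 :=
  if 2^-1 <= `|x| then (if e * x ^+ 2 < k * z * x then inord 2 else ord0)
  else inord 1.

Lemma vote2E k e z x :
  (vote k e z x == 2%N :> nat) = (2^-1 <= `|x|) && (e * x ^+ 2 < k * z * x).
Proof. by rewrite /vote; case: ifP => _; [case: ifP|]; rewrite ?inordK. Qed.

Lemma vote0E k e z x :
  (vote k e z x == 0%N :> nat) = (2^-1 <= `|x|) && (k * z * x <= e * x ^+ 2).
Proof.
by rewrite /vote [k * z * x <= _]leNgt; case: ifP => _; [case: ifP|]; rewrite ?inordK.
Qed.

Lemma vote1E k e z x : (vote k e z x == 1%N :> nat) = (`|x| < 2^-1).
Proof.
by rewrite /vote [`|x| < _]ltNge; case: ifP => _; [case: ifP|]; rewrite ?inordK.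
Qed.

(** This form and the next match the two median bounds: [median_gt_count] counts weak inequalities,
    [median_lt_count] strict ones. *)
Lemma vote_sub1 k e z x : (vote k e z x)%:R - 1 =
  (2^-1 <= `|x|)%R%:R - 2 * ((2^-1 <= `|x|) && (k * z * x <= e * x ^+ 2))%R%:R :> R.
Proof.
rewrite /vote [k * z * x <= _]leNgt; case: ifP => _; [case: ifP => _|];
  rewrite ?inordK//=; lra.
Qed.

Lemma vote_sub1_gt k e z x : (vote k e z x)%:R - 1 =
  2 * ((2^-1 <= `|x|) && (e * x ^+ 2 < k * z * x))%R%:R - (2^-1 <= `|x|)%R%:R :> R.
Proof.
rewrite /vote; case: ifP => _; [case: ifP => _|]; rewrite ?inordK//=; lra.
Qed.

Lemma measurable_vote {d : measure_display} {U : measurableType d} k e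
    (z x : U -> R) (a : 'I_3) :
  measurable_fun setT z -> measurable_fun setT x ->
  measurable [set u | vote k e (z u) (x u) = a].
Proof.
move=> mz mx.
have -> : [set u | vote k e (z u) (x u) = a] =
    [set u | vote k e (z u) (x u) == a :> nat].
  by apply/seteqP; split => u /= => [->//|/eqP]; exact: val_inj.
case: a => [[|[|[|//]]]] /= _.
- by under eq_set do rewrite vote0E; exact: measurable_bias_le.
- under eq_set do rewrite vote1E.
  by apply: measurable_set_lt => //; exact: measurableT_comp.
- by under eq_set do rewrite vote2E; exact: measurable_bias_gt.
Qed.

End vote.

Section median_error.
Context {R : realType} (n d : nat) (beta : 'I_d -> R) (eta sg w : 'I_n -> R)
  (X : 'I_n -> 'I_d -> R) (j : 'I_d) (e : R).
Context (sg1 : forall i, sg i = 1 \/ sg i = -1).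

Let y i := \sum_(l < d) X i l * beta l + eta i.
Let z i := eta i + sg i * w i + \sum_(l < d | l != j) beta l * X i l.

(** The sign squares to 1 and the term in [beta j] cancels: comparing the observed ratio with
    [beta j + r] amounts to comparing [z i / X i j] with [r], both multiplied through by the square
    of the denominator. *)
Lemma ratio_subE i r :
  (sg i * y i + w i) * (sg i * X i j) - (beta j + r) * (sg i * X i j) ^+ 2 =
  z i * X i j - r * X i j ^+ 2.
Proof.
rewrite /y /z (bigD1 j)//= (eq_bigr (fun l => beta l * X i l)); last first.
  by move=> l _; rewrite mulrC.
by case: (sg1 i) => ->; ring.
Qed.

Lemma norm_sign_mul i : `|sg i * X i j| = `|X i j|.
Proof. by rewrite normrM; case: (sg1 i) => ->; rewrite ?normrN normr1 mul1r. Qed.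

(** The sum of the votes is exactly the size of the list minus twice the number of ratios at most
    [beta j + e]. *)
Lemma median_error_gt : e < cm_beta' sg w y X j - beta j ->
  0 <= \sum_i ((vote 1 e (z i) (X i j))%:R - 1 : R).
Proof.
rewrite ltrBrDl => /median_gt_count; rewrite count_filter_enum size_filter_enum.
rewrite -muln2 mulnC -(ler_nat R) natrM !natr_sum -subr_ge0 mulr_sumr -sumrB.
move=> /le_trans; apply; rewrite le_eqVlt; apply/orP; left; apply/eqP.
apply: eq_bigr => i _; rewrite vote_sub1 norm_sign_mul mul1r.
congr (_ - 2 * (nat_of_bool _)%:R); case: (boolP (2^-1 <= _)) => //= h.
rewrite le_div_mul; last by rewrite norm_sign_mul; apply: lt_le_trans h; rewrite invr_gt0.
by rewrite -subr_le0 ratio_subE subr_le0.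
Qed.

Lemma median_error_lt : cm_beta' sg w y X j - beta j < - e ->
  0 <= \sum_i ((vote (-1) e (z i) (X i j))%:R - 1 : R).
Proof.
rewrite ltrBlDl => /median_lt_count; rewrite count_filter_enum size_filter_enum.
rewrite -muln2 mulnC -(ler_nat R) natrM !natr_sum -subr_ge0 mulr_sumr -sumrB.
move=> /le_trans; apply; rewrite le_eqVlt; apply/orP; left; apply/eqP.
apply: eq_bigr => i _; rewrite vote_sub1_gt norm_sign_mul.
congr (2 * (nat_of_bool _)%:R - _); case: (boolP (2^-1 <= _)) => //= h.
rewrite lt_div_mul; last by rewrite norm_sign_mul; apply: lt_le_trans h; rewrite invr_gt0.
by rewrite -subr_lt0 ratio_subE -[RHS]subr_lt0; congr (_ < 0); ring.
Qed.

End median_error.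

(** * The law of the votes *)

Section rows.
Context {R : realType} {dT : measure_display} {T : measurableType dT}
        (P : probability T R).
Context (n d : nat) (beta : 'I_d -> R) (eta : 'I_n -> R)
        (X : 'I_n -> 'I_d -> T -> R) (w sg : 'I_n -> T -> R).
Context (gX : forall i j, std_gaussian P (X i j)) (gw : forall i, std_gaussian P (w i))
        (gsg : forall i, rademacher P (sg i))
        (iZ : mutually_independent P (rand_family X w sg)).

Definition noise (j : 'I_d) (i : 'I_n) (t : T) : R :=
  eta i + sg i t * w i t + \sum_(l < d | l != j) beta l * X i l t.

Definition noise_sd (j : 'I_d) : R :=
  Num.sqrt (1 + \sum_(l < d | l != j) beta l ^+ 2).

Definition row_of (a : 'I_n * 'I_d + 'I_n + 'I_n) : 'I_n :=
  match a with inl (inl ij) => ij.1 | inl (inr i) => i | inr i => i end.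

Lemma measurable_rand_family a : measurable_fun setT (rand_family X w sg a).
Proof.
by case: a => [[[i j]|i]|i]; [exact: (gX i j).1|exact: (gw i).1|exact: (gsg i).1].
Qed.

(** The partition is arbitrary because three are used: a single block, [X i j] against everything
    else, and one block per row. *)
Lemma measurable_noise_block (K : finType) (blk : 'I_n * 'I_d + 'I_n + 'I_n -> K)
    k j i :
  blk (inr i) = k -> blk (inl (inr i)) = k ->
  (forall l, l != j -> blk (inl (inl (i, l))) = k) ->
  measurable_fun setT
    (noise j i : g_sigma_algebraType (block_sys (rand_family X w sg) blk k) -> R).
Proof.
move=> hs hw hX.
have ms : measurable_fun setT
    (sg i : g_sigma_algebraType (block_sys (rand_family X w sg) blk k) -> R).
  exact: (measurable_in_block (Z := rand_family X w sg) hs).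
have mw : measurable_fun setT
    (w i : g_sigma_algebraType (block_sys (rand_family X w sg) blk k) -> R).
  exact: (measurable_in_block (Z := rand_family X w sg) hw).
apply: measurable_funD.
  by apply: measurable_funD => //; exact: measurable_funM.
under eq_fun do rewrite -big_filter.
apply: measurable_sum_in => l; rewrite mem_filter => /andP[lj _].
apply: measurable_funM => //.
exact: (measurable_in_block (Z := rand_family X w sg) (hX l lj)).
Qed.

Lemma measurable_noise j i : measurable_fun setT (noise j i).
Proof.
apply: (@block_measurable_fun _ _ _ _ _ (rand_family X w sg) (fun=> tt) measurable_rand_family _ _ tt).
exact: measurable_noise_block.
Qed.

(** The signed Gaussian noise gives variance 1 around [eta i]; the terms [beta l * X i l] are then
    added by [lincomb_normal_law]. *)
Lemma noise_law j i : normal_law P (noise j i) (eta i) (noise_sd j).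
Proof.
pose b (a : 'I_n * 'I_d + 'I_n + 'I_n) : R := if a is inl (inl il) then beta il.2 else 0.
pose s : seq ('I_n * 'I_d + 'I_n + 'I_n) :=
  [seq inl (inl (i, l)) | l <- [seq l <- index_enum 'I_d | l != j]].
pose f t := eta i + sg i t * w i t.
have us : uniq s.
  rewrite map_inj_uniq ?filter_uniq ?index_enum_uniq//.
  by move=> l l' [].
have ms := measurable_rand_family (inr i).
have mw := measurable_rand_family (inl (inr i)).
have isw : indep_pair P (sg i) (w i).
  apply: (@indep_block_pair _ _ _ P _ _ (rand_family X w sg)
    (fun a => a == inr i) measurable_rand_family iZ _ _ _ _ true false) => //.
    by apply: (measurable_in_block (Z := rand_family X w sg) (i := inr i)); exact: eqxx.
  exact: (measurable_in_block (Z := rand_family X w sg) (i := inl (inr i))).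
have fE : normal_law P f (eta i) 1.
  by apply: rademacher_mul_law => //; exact: (gw i).2.
have mf : measurable_fun setT f by apply: measurable_funD => //; exact: measurable_funM.
have := @lincomb_normal_law _ _ _ P _ _ measurable_rand_family iZ f (eta i) 1 b s us ltr01 fE.
rewrite expr1n !big_map !big_filter => h.
have -> : noise j i = fun t => f t + \sum_(l <- s) b l * rand_family X w sg l t.
  by apply/funext => t; rewrite /noise big_map big_filter.
apply: h => //.
- by move=> _ /mapP[l _ ->]; exact: (gX i l).2.
- move=> _ /mapP[l _ ->].
  apply: measurable_funD => //; apply: measurable_funM.
    exact: (measurable_in_block (Z := rand_family X w sg) (i := inr i)).
  exact: (measurable_in_block (Z := rand_family X w sg) (i := inl (inr i))).
Qed.

Lemma noise_indep j i : indep_pair P (noise j i) (X i j).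
Proof.
apply: (@indep_block_pair _ _ _ P _ _ (rand_family X w sg)
    (fun a => a == inl (inl (i, j))) measurable_rand_family iZ _ _ _ _ false true) => //.
  apply: measurable_noise_block => // l lj.
  by apply/negbTE; apply: contra lj => /eqP[->].
by apply: (measurable_in_block (Z := rand_family X w sg) (i := inl (inl (i, j)))); exact: eqxx.
Qed.

Lemma noise_sd_ge1 j : 1 <= noise_sd j.
Proof.
rewrite -[leLHS]sqrtr1 ler_wsqrtr// lerDl.
by apply: sumr_ge0 => l _; rewrite sqr_ge0.
Qed.

Lemma noise_sd_le j : noise_sd j <= Num.sqrt (1 + sqnorm beta).
Proof.
by rewrite ler_wsqrtr// lerD2l /sqnorm [leRHS](bigD1 j)//= lerDr sqr_ge0.
Qed.

(* 288 = 24 * 12, from [normal_prob_ball] and [normal_prob_std_tail]. *)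
Lemma noise_small_ball j i (dl : R) : `|eta i| <= 1 -> 0 <= dl <= 1 ->
  ((dl / 288)%:E <=
   P [set t | `|noise j i t| <= (2 * dl * Num.sqrt (1 + sqnorm beta)) / 2]%R *
   P [set t | 2^-1 <= `|X i j t|]%R)%E.
Proof.
move=> eta1 /andP[d0 d1].
have m1 (c : R) : measurable [set x : R | `|x| <= c] by exact: measurable_norm_le.
have m2 (c : R) : measurable [set x : R | c <= `|x|] by exact: measurable_norm_ge.
have h1 : ((dl / 24)%:E <=
    P [set t | `|noise j i t| <= (2 * dl * Num.sqrt (1 + sqnorm beta)) / 2]%R)%E.
  have /le_trans : ((dl / 24)%:E <= P [set t | (`|noise j i t| <= dl * noise_sd j)%R])%E.
    have d01 : 0 <= dl <= 1 by rewrite d0.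
    apply: le_trans (normal_prob_ball (noise_sd_ge1 j) eta1 d01) _.
    by rewrite -(noise_law j i (m1 _)).
  apply; apply: le_measure; rewrite ?inE.
  - by apply: measurable_norm_le; exact: measurable_noise.
  - by apply: measurable_norm_le; exact: measurable_noise.
  move=> t /= /le_trans; apply.
  rewrite (_ : 2 * dl * _ / 2 = dl * Num.sqrt (1 + sqnorm beta)); last by field.
  by rewrite ler_wpM2l// noise_sd_le.
have h2 : ((12^-1)%:E <= P [set t | 2^-1 <= `|X i j t|]%R)%E.
  by apply: le_trans normal_prob_std_tail _; rewrite -((gX i j).2 _ (m2 _)).
rewrite (_ : dl / 288 = dl / 24 * 12^-1); last by field.
by rewrite EFinM; apply: lee_pmul => //; rewrite lee_fin ?divr_ge0.
Qed.

Definition vote_at (k e : R) j i t : 'I_3 := vote k e (noise j i t) (X i j t).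

Lemma measurable_vote_at k e j i a : measurable [set t | vote_at k e j i t = a].
Proof.
by apply: measurable_vote; [exact: measurable_noise|exact: (gX i j).1].
Qed.

(** Each vote is a function of the variables of its own row. *)
Lemma indep_votes k e j (a : 'I_n -> 'I_3) :
  P (\bigcap_(i in setT) [set t | vote_at k e j i t = a i]) =
  (\prod_i P [set t | vote_at k e j i t = a i])%E.
Proof.
apply: (indep_blocks measurable_rand_family iZ (blk := row_of)) => i.
apply: (@measurable_vote _ _ (g_sigma_algebraType (block_sys (rand_family X w sg) row_of i))).
  exact: measurable_noise_block.
exact: (measurable_in_block (Z := rand_family X w sg) (i := inl (inl (i, j)))).
Qed.

Lemma vote_bias (k dl e : R) j i : k = 1 \/ k = -1 -> 0 <= dl <= 1 ->
  e = 2 * dl * Num.sqrt (1 + sqnorm beta) ->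
  (P [set t | vote_at k e j i t = 2%N :> nat] +
     (if (`|eta i| <= 1)%R then dl / 288 else 0)%:E <=
   P [set t | vote_at k e j i t = 0%N :> nat])%E.
Proof.
move=> k1 d01 eE; have e0 : 0 <= e.
  by case/andP: d01 => d0 _; rewrite eE !mulr_ge0.
have := ratio_bias (measurable_noise j i) (gX i j).1 (@noise_indep j i)
  (@noise_law j i) (gX i j).2 e0 k1.
have -> : [set t | vote_at k e j i t = 2%N :> nat] =
    [set t | (2^-1 <= `|X i j t|) && (e * X i j t ^+ 2 < k * noise j i t * X i j t)].
  by apply/seteqP; split => t /=; rewrite -vote2E => /eqP.
have -> : [set t | vote_at k e j i t = 0%N :> nat] =
    [set t | (2^-1 <= `|X i j t|) && (k * noise j i t * X i j t <= e * X i j t ^+ 2)].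
  by apply/seteqP; split => t /=; rewrite -vote0E => /eqP.
apply: le_trans; apply: leeD2l; case: ifP => [eta1|_]; last by rewrite mule_ge0.
by rewrite eE; exact: noise_small_ball.
Qed.

(** The biases sum to at least [alpha * n * dl / 288], and [dl] is chosen so that
    [dl ^+ 2 * alpha ^+ 2 * n = tau], which makes the Chernoff exponent a multiple of [tau]. *)
Lemma coordinate_tail (k alpha tau e : R) j : k = 1 \/ k = -1 ->
  0 < alpha -> alpha <= 1 ->
  alpha * n%:R <= #|[set i : 'I_n | `|eta i| <= 1]%SET|%:R ->
  0 < tau -> tau <= alpha ^+ 2 * n%:R ->
  e = 2 * Num.sqrt (tau / (alpha ^+ 2 * n%:R)) * Num.sqrt (1 + sqnorm beta) ->
  (P [set t | 0 <= \sum_i ((vote_at k e j i t)%:R - 1 : R)]%R <=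
   (expR (- (tau / (1152 * 576))))%:E)%E.
Proof.
move=> k1 a0 a1 hcard t0 ht.
set dl := Num.sqrt (tau / (alpha ^+ 2 * n%:R)) => eE.
have an0 : 0 < alpha ^+ 2 * n%:R by apply: lt_le_trans ht.
have dl0 : 0 <= dl by rewrite sqrtr_ge0.
have dl2 : dl ^+ 2 * (alpha ^+ 2 * n%:R) = tau.
  by rewrite sqr_sqrtr ?divr_ge0 ?(ltW t0) ?(ltW an0)// divfK// gt_eqF.
(* This is where [tau <= alpha ^+ 2 * n] matters: the small-ball bound requires [dl <= 1]. *)
have dl1 : dl <= 1.
  by rewrite -[leRHS]sqrtr1 ler_wsqrtr// ler_pdivrMr// mul1r.
have dl01 : 0 <= dl <= 1 by rewrite dl0.
(* With mu = alpha * dl / 288 the mean bias of a vote, lam = mu / 4 makes the exponent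
   2 n lam^2 - n mu lam equal to - n mu^2 / 8. *)
pose lam := alpha * dl / 1152.
have adl : 0 <= alpha * dl <= 1.
  by rewrite mulr_ge0 ?(ltW a0)//= mulr_ile1// ltW.
have lam01 : 0 <= lam <= 2^-1 by rewrite /lam; lra.
pose p i : R := if `|eta i| <= 1 then dl / 288 else 0.
have := ternary_chernoff (measurable_vote_at k e j) (indep_votes k e j)
  (p := p) (fun i => vote_bias j i k1 dl01 eE) lam01.
move=> /le_trans; apply; rewrite lee_fin ler_expR.
have sump : alpha * n%:R * (dl / 288) <= \sum_i p i.
  rewrite (_ : \sum_i p i = #|[set i : 'I_n | `|eta i| <= 1]%SET|%:R * (dl / 288)).
    by rewrite ler_wpM2r// divr_ge0.
  rewrite -sum1_card natr_sum mulr_suml [RHS]big_mkcond; apply: eq_bigr => i _ /=.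
  by rewrite inE /p; case: ifP; rewrite ?mul1r.
have lam0 : 0 <= lam by case/andP: lam01.
(* As [1152 * 288 = 576 * 576], the linear term is twice the quadratic one, and their difference is
   [tau / (1152 * 576)]. *)
have := ler_wpM2l lam0 sump.
have -> : lam * (alpha * n%:R * (dl / 288)) = tau / (576 * 576) by rewrite -dl2 /lam; field.
have -> : 2 * n%:R * lam ^+ 2 = tau / (1152 * 576) by rewrite -dl2 /lam; field.
lra.
Qed.

End rows.

(** * Union bound over the coordinates and both signs of the error *)

Theorem mainTheorem15 :
  exists c C : rat, (0 < c)%R /\ (0 < C)%R /\
  forall R : realType,
  forall (n d k : nat) (beta : 'I_d -> R) (eta : 'I_n -> R) (alpha tau : R),
    (#|[set j : 'I_d | beta j != 0%R]%SET| <= k)%N ->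
    0 < alpha -> alpha <= 1 ->
    alpha * n%:R <= #|[set i : 'I_n | `|eta i| <= 1]%SET|%:R ->
    0 < tau -> tau <= alpha ^+ 2 * n%:R ->
    forall (dT : measure_display) (T : measurableType dT) (P : probability T R)
      (X : 'I_n -> 'I_d -> T -> R) (w sg : 'I_n -> T -> R),
      (forall i j, std_gaussian P (X i j)) ->
      (forall i, std_gaussian P (w i)) ->
      (forall i, rademacher P (sg i)) ->
      mutually_independent P (rand_family X w sg) ->
      let y := fun t (i : 'I_n) => \sum_(j < d) X i j t * beta j + eta i in
      let betahat := fun t =>
        hard_threshold k (cm_beta' (fun i => sg i t) (fun i => w i t) (y t)
                                   (fun i j => X i j t)) in
      ((1 - 2 * expR (ln d%:R - ratr c * tau))%:E <=
       P [set t | (sqnorm (fun j => beta j - betahat t j)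
                  <= ratr C * (k%:R * tau / (alpha ^+ 2 * n%:R)) * (1 + sqnorm beta))%R])%E.
Proof.
(* The first constant is the rate of [coordinate_tail]; the second is 5 from hard thresholding times
   4 from [e ^+ 2]. *)
exists (1152%:R * 576%:R)^-1, 20%:R; split.
  by rewrite invr_gt0 mulr_gt0 ?ltr0n.
split; first by rewrite ltr0n.
move=> R n d k beta eta alpha tau sk a0 a1 hcard t0 ht dT T P X w sg gX gw gsg iZ; cbv zeta.
rewrite fmorphV rmorphM/= !ratr_nat.
set bound := 20%:R * _ * _.
set E := [set t | _].
pose dl := Num.sqrt (tau / (alpha ^+ 2 * n%:R)).
pose e := 2 * dl * Num.sqrt (1 + sqnorm beta).
have sq0 : 0 <= 1 + sqnorm beta.
  by rewrite addr_ge0// sumr_ge0// => l _; rewrite sqr_ge0.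
have e0 : 0 <= e by rewrite !mulr_ge0 ?sqrtr_ge0.
have an0 : 0 < alpha ^+ 2 * n%:R by apply: lt_le_trans ht.
have e2 : e ^+ 2 = 4 * (tau / (alpha ^+ 2 * n%:R)) * (1 + sqnorm beta).
  rewrite /e !exprMn !sqr_sqrtr//; first by congr (_ * _ * _); ring.
  by rewrite divr_ge0 ?(ltW t0) ?(ltW an0).
have mE : measurable E.
  apply: measurable_set_le => //.
  apply: measurable_sum => j; apply: measurable_funX; apply: measurable_funB => //.
  apply: measurable_hard_threshold => l.
  apply: measurable_cm_beta' => //.
  - by move=> i; exact: (gsg i).1.
  - by move=> i; exact: (gw i).1.
  - move=> i; apply: measurable_funD => //; apply: measurable_sum => l'.
    by apply: measurable_funM => //; exact: (gX i l').1.
  - by move=> i l'; exact: (gX i l').1.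
(* [q = 1] stands for overestimating coordinate [j] by more than [e], [q = -1] for underestimating
   it. *)
pose bad (q : R) j := [set t | 0 <= \sum_i ((vote_at beta eta X w sg q e j i t)%:R - 1 : R)].
have mbad q j : measurable (bad q j).
  by apply: measurable_ternary_sum => i a; exact: measurable_vote_at.
pose B := \big[setU/set0]_(j < d) (bad 1 j `|` bad (-1) j).
have mB : measurable B.
  by apply: bigsetU_measurable => j _; exact: measurableU.
(* A deterministic inclusion: off [B] every coordinate of the median estimate is within [e], and
   [hard_threshold_error] applies. *)
have EB : ~` E `<=` B.
  move=> t nE; apply: contrapT => nB; apply: nE; rewrite /E /=.
  have nbad j : ~ (bad 1 j `|` bad (-1) j) t.
    by move=> bt; apply: nB; rewrite /B -bigcup_seq; exists j => //=; rewrite mem_index_enum.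
  apply: le_trans (hard_threshold_error e0 sk _) _ => [j|].
    rewrite distrC ler_norml; apply/andP; split; rewrite leNgt; apply/negP => h; apply: (nbad j).
      by right; apply: (median_error_lt _ h) => i; exact: (gsg i).2.1.
    by left; apply: (median_error_gt _ h) => i; exact: (gsg i).2.1.
  by rewrite e2 /bound le_eqVlt; apply/orP; left; apply/eqP; ring.
have PB : (P (~` E) <= (2 * (d%:R * expR (- (tau / (1152 * 576)))))%:E)%E.
  apply: (@le_trans _ _ (P B)).
    by apply: le_measure; rewrite ?inE//; exact: measurableC.
  apply: le_trans (measure_bigsetU_le _ _ _ _) _ => [j|]; first exact: measurableU.
  apply: (@le_trans _ _ (\sum_(j < d) (2 * expR (- (tau / (1152 * 576))))%:E)%E).
    apply: lee_sum => j _; apply: le_trans (measureU2 _ _ _) _ => //.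
    have -> : 2 * expR (- (tau / (1152 * 576))) =
      expR (- (tau / (1152 * 576))) + expR (- (tau / (1152 * 576))) :> R by ring.
    rewrite EFinD; apply: leeD.
      by apply: (coordinate_tail gX gw gsg iZ j _ a0 a1 hcard t0 ht erefl); left.
    by apply: (coordinate_tail gX gw gsg iZ j _ a0 a1 hcard t0 ht erefl); right.
  by rewrite sumEFin lee_fin sumr_const card_ord -mulr_natr; lra.
have -> : P E = (1 - P (~` E))%E.
  by rewrite -[in LHS](setCK E) probability_setC//; exact: measurableC.
rewrite EFinB; apply: leeB => //; apply: le_trans PB _.
rewrite lee_fin ler_wpM2l// mulrC [(1152 * 576)^-1 * tau]mulrC.
(* [expR (ln d) = d] requires [0 < d]; for [d = 0] the failure bound is 0 and positivity of the
   exponential suffices. *)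
have [d0|d0] := posnP d; first by rewrite d0 mulr0 expR_ge0.
by rewrite expRD lnK ?posrE ?ltr0n// mulrC.
Qed.
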